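(* Let $N\ge1$, let $\mathcal V$ be the algebra of difference polynomials in the infinitely many variables $u_i$, $i\in\mathbb Z_{\le N-1}$, and let $$L(S)=S^N+\sum_{i\le N-1}u_iS^i\in\mathcal V((S^{-1}))$$ be the pseudodifference operator of generic type of order $N$. Endow $\mathcal V$ with the multiplicative Poisson vertex algebra structure given by $$\{{u_i}_\lambda u_j\}_1^{(L)}=\epsilon_{ij}\big((\lambda S)^{-i}-\lambda^j\big)u_{i+j},\qquad i,j\le N-1,$$ where $\epsilon_{ij}=1$ if $i,j\ge1$, $\epsilon_{ij}=-1$ if $i,j\le0$, $\epsilon_{ij}=0$ otherwise, and on the right-hand side $u_N=1$ and $u_k=0$ for $k>N$. Let $h_n=-\frac1n\,\mathrm{mRes}_zL^n(z)$, $n\ge1$. Then $$\frac{dL(w)}{dt_n}=\{\textstyle\int h_n,L(w)\}_1^{(L)}=[(L^{n-1})_+,L](w),\qquad n\in\mathbb Z_{\ge1},$$ is an integrable hierarchy of Hamiltonian equations in $\mathcal V$ (with the infinitely many linearly independent integrals of motion in involution $\int h_n$, $n\ge1$).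
   Context: The base field $\mathbb F$ has characteristic $0$. The algebra of difference polynomials in variables $u_i$ is the polynomial algebra in independent variables $S^k(u_i)$, $k\in\mathbb Z$, with shift automorphism $S$. A multiplicative Poisson vertex algebra (mPVA) is a unital commutative associative algebra $\mathcal V$ with automorphism $S$ and a linear map $\mathcal V\otimes\mathcal V\to\mathcal V[\lambda,\lambda^{-1}]$, $a\otimes b\mapsto\{a_\lambda b\}$, with: $\{S(a)_\lambda b\}=\lambda^{-1}\{a_\lambda b\}$, $\{a_\lambda S(b)\}=\lambda S\{a_\lambda b\}$; $\{a_\lambda bc\}=\{a_\lambda b\}c+\{a_\lambda c\}b$; $\{ab_\lambda c\}=\sum_n(p_nS^n(b)+q_nS^n(a))\lambda^n$ where $\{a_\lambda c\}=\sum_np_n\lambda^n$, $\{b_\lambda c\}=\sum_nq_n\lambda^n$; $\{b_\lambda a\}=-\sum_nS^{-n}(c_n)\lambda^{-n}$ if $\{a_\lambda b\}=\sum_nc_n\lambda^n$; $\{a_\lambda\{b_\mu c\}\}-\{b_\mu\{a_\lambda c\}\}=\{\{a_\lambda b\}_{\lambda\mu}c\}$. The values on generators extend uniquely to $\mathcal V$ by sesquilinearity and the Leibniz rules. $(\lambda S)^{-i}u_{k}$ means $\lambda^{-i}S^{-i}(u_k)$. Hamiltonian functionals are elements of $\mathcal V/(S-1)\mathcal V$, with quotient map $\int$; $\{\int a,\int b\}=\int\{a_\lambda b\}|_{\lambda=1}$ is a Lie bracket and $\{\int a,b\}=\{a_\lambda b\}|_{\lambda=1}$ an action by derivations of $\mathcal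 V$ commuting with $S$. The Hamiltonian equation of $\int h$ is $\frac{du}{dt}=\{\int h,u\}$, $u\in\mathcal V$; it is integrable if it has infinitely many linearly independent integrals of motion (including $\int h$) in involution $\int h_n$, i.e. $\{\int h_m,\int h_n\}=0$ for all $m,n$; the equations $\frac{du}{dt_n}=\{\int h_n,u\}$ then form an integrable hierarchy. $\mathcal V((S^{-1}))$ has coefficients on the left and product determined by $S\circ f=S(f)S$. For $A(S)=\sum_na_nS^n$: symbol $A(z)=\sum_na_nz^n$, $A_+=\sum_{n\ge0}a_nS^n$, $\mathrm{mRes}_zA(z)=a_0$; $L^n(z)$ is the symbol of the $n$-th power of $L(S)$ and $[A,B](w)$ the symbol of the commutator. *)

(* Defs.v *)
From HB Require Import structures.
From mathcomp Require Import all_boot all_order all_algebra.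
From mathcomp Require Import finmap.
From mathcomp.multinomials Require Import monalg.

Set Implicit Arguments.
Unset Strict Implicit.
Unset Printing Implicit Defensive.

Import Order.TTheory GRing.Theory Num.Theory.
Local Open Scope ring_scope.

Record algAut (F : fieldType) (V : comAlgType F) := AlgAut {
  aut_fun :> {lrmorphism V -> V};
  aut_inv : V -> V;
  autK : cancel aut_fun aut_inv;
  autKV : cancel aut_inv aut_fun
}.

Definition autz (F : fieldType) (V : comAlgType F) (S : algAut V) (n : int) :
    V -> V :=
  match n with
  | Posz k => iter k (aut_fun S)
  | Negz k => iter k.+1 (aut_inv S)
  end.

(* V[λ, λ^-1] is {malg V[int]}: finitely supported maps from int to V, where
   p@_n is the coefficient of λ^n and << c *g n >> is c λ^n. *)
Notation laurent V := {malg V[int]}.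

Definition laurent_at1 (V : zmodType) (p : laurent V) : V :=
  \sum_(n <- msupp p) p@_n.

(* The axioms of a multiplicative λ-bracket, read off coefficient by
   coefficient: (br a b)@_n is the coefficient of λ^n in {a_λ b}. In
   mpva_jacobi one compares the coefficients of λ^m μ^n; if
   {a_λ b} = \sum_k d_k λ^k, the right-hand side of the Jacobi identity is
   \sum_k λ^k {d_k _{λμ} c}, to which only k = m - n contributes. *)
Record isMPVA (F : fieldType) (V : comAlgType F) (S : algAut V)
    (br : V -> V -> laurent V) : Prop := IsMPVA {
  mpva_linearl : forall (x : F) (a a' b : V) (n : int),
    (br (x *: a + a') b)@_n = x *: (br a b)@_n + (br a' b)@_n;
  mpva_linearr : forall (x : F) (a b b' : V) (n : int),
    (br a (x *: b + b'))@_n = x *: (br a b)@_n + (br a b')@_n;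
  mpva_sesquil : forall (a b : V) (n : int),
    (br (S a) b)@_n = (br a b)@_(n + 1);
  mpva_sesquir : forall (a b : V) (n : int),
    (br a (S b))@_n = S (br a b)@_(n - 1);
  mpva_leibnizr : forall (a b c : V) (n : int),
    (br a (b * c))@_n = (br a b)@_n * c + (br a c)@_n * b;
  mpva_leibnizl : forall (a b c : V) (n : int),
    (br (a * b) c)@_n = (br a c)@_n * autz S n b + (br b c)@_n * autz S n a;
  mpva_skew : forall (a b : V) (n : int),
    (br b a)@_n = - autz S n (br a b)@_(- n);
  mpva_jacobi : forall (a b c : V) (m n : int),
    (br a (br b c)@_n)@_m - (br b (br a c)@_m)@_n
      = (br (br a b)@_(m - n) c)@_n
}.

(* Elements of V / (S - 1) V are handled through representatives:
   \int a = \int b means that a - b lies in (S - 1) V. *)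
Definition eq_int (F : fieldType) (V : comAlgType F) (S : algAut V)
    (a b : V) : Prop :=
  exists c : V, a - b = S c - c.

(* {\int a, b}; it is also a representative of {\int a, \int b}. *)
Definition ham_action (F : fieldType) (V : comAlgType F)
    (br : V -> V -> laurent V) (a b : V) : V :=
  laurent_at1 (br a b).

Definition lin_indep_int (F : fieldType) (V : comAlgType F) (S : algAut V)
    (h : nat -> V) : Prop :=
  forall (k : nat) (x : 'I_k -> F),
    eq_int S (\sum_(i < k) x i *: h i) 0 -> forall i, x i = 0.

Definition in_involution (F : fieldType) (V : comAlgType F) (S : algAut V)
    (br : V -> V -> laurent V) (h : nat -> V) : Prop :=
  forall m n : nat, eq_int S (ham_action br (h m) (h n)) 0.

(* The Hamiltonian equation du/dt = {\int g, u} is integrable. *)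
Definition integrable_eqn (F : fieldType) (V : comAlgType F) (S : algAut V)
    (br : V -> V -> laurent V) (g : V) : Prop :=
  exists h : nat -> V,
    [/\ exists k, eq_int S (h k) g, lin_indep_int S h & in_involution S br h].

(* The equations du/dt_n = {\int h_n, u} form an integrable hierarchy; each of
   them is integrable_eqn with the family h itself as witness. *)
Definition integrable_hierarchy (F : fieldType) (V : comAlgType F)
    (S : algAut V) (br : V -> V -> laurent V) (h : nat -> V) : Prop :=
  lin_indep_int S h /\ in_involution S br h.

Lemma integrable_hierarchyW (F : fieldType) (V : comAlgType F) (S : algAut V)
    (br : V -> V -> laurent V) (h : nat -> V) (n : nat) :
  integrable_hierarchy S br h -> integrable_eqn S br (h n).
Proof.
move=> [hfree hinv]; exists h; split=> //; exists n, 0.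
by rewrite /= rmorph0 !subrr.
Qed.

(* PDO d c is the pseudodifference operator \sum_(k >= 0) c_k S^(d - k). The
   leading coefficient c_0 may vanish, so an element of V((S^-1)) has several
   such presentations; two of them are compared through their symbols. *)
Record pdo (V : Type) := PDO { pdo_deg : int; pdo_coef : nat -> V }.

(* The coefficient of S^n, that is, of z^n in the symbol. *)
Definition symbol (V : zmodType) (A : pdo V) (n : int) : V :=
  if n <= pdo_deg A then pdo_coef A `|pdo_deg A - n|%N else 0.

Definition pdo_one (V : pzRingType) : pdo V := PDO 0 (fun k => (k == 0%N)%:R).

Definition pdo_sub (V : zmodType) (A B : pdo V) : pdo V :=
  let d := Num.max (pdo_deg A) (pdo_deg B) in
  PDO d (fun k => symbol A (d - k%:Z) - symbol B (d - k%:Z)).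

(* (a S^p) (b S^q) = a S^p(b) S^(p + q) *)
Definition pdo_mul (F : fieldType) (V : comAlgType F) (S : algAut V)
    (A B : pdo V) : pdo V :=
  PDO (pdo_deg A + pdo_deg B)
      (fun k => \sum_(i < k.+1)
         pdo_coef A i
           * autz S (pdo_deg A - (i : nat)%:Z) (pdo_coef B (k - i)%N)).

Definition pdo_exp (F : fieldType) (V : comAlgType F) (S : algAut V)
    (A : pdo V) (n : nat) : pdo V :=
  iter n (pdo_mul S A) (pdo_one V).

Definition pdo_comm (F : fieldType) (V : comAlgType F) (S : algAut V)
    (A B : pdo V) : pdo V :=
  pdo_sub (pdo_mul S A B) (pdo_mul S B A).

Definition pdo_plus (V : zmodType) (A : pdo V) : pdo V :=
  PDO (pdo_deg A)
      (fun k => if 0 <= pdo_deg A - k%:Z then pdo_coef A k else 0).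

Definition mRes (V : zmodType) (A : pdo V) : V := symbol A 0.

(* The algebra of difference polynomials in the variables u_i, i : I; the pair
   (i, k) indexes the variable S^k(u_i). *)
Definition dvar (I : choiceType) : choiceType := (I * int)%type.
Notation diffpoly F I := {malg F[{cmonom dvar I}]}.

Definition dX (F : fieldType) (I : choiceType) (x : dvar I) : diffpoly F I :=
  << ucm x >>.

(* The substitution S^l(u_i) |-> S^(l + k)(u_i), on monomials and on V. *)
Definition shift_mon (F : fieldType) (I : choiceType) (k : int)
    (m : {cmonom dvar I}) : diffpoly F I :=
  \prod_(x <- finsupp m) dX F (x.1, x.2 + k) ^+ m x.

HB.lock Definition shift (F : fieldType) (I : choiceType) (k : int)
    (p : diffpoly F I) : diffpoly F I :=
  mmap (@mkmalgU {cmonom dvar I} F mone) (shift_mon F k) p.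

Section DiffPoly.
Variables (F : fieldType) (I : choiceType).
Local Notation V := (diffpoly F I).
Local Notation dX := (@dX F I).
Local Notation shift_mon := (@shift_mon F I).
Local Notation shift := (@shift F I).

Lemma shift_monEw k (d : {fset dvar I}) (m : {cmonom dvar I}) :
  (finsupp m `<=` d)%fset ->
  shift_mon k m = \prod_(x <- d) dX (x.1, x.2 + k) ^+ m x.
Proof.
move=> le; rewrite /shift_mon (big_fset_incl _ le) // => x _ xm.
by move: xm; rewrite -cmE_eq0 => /eqP ->; rewrite expr0.
Qed.

Lemma shift_mon_is_mmorphism k : mmorphism (shift_mon k).
Proof.
split=> [m1 m2|]; last by rewrite /shift_mon mdom1 big_seq_fset0.
rewrite [LHS](@shift_monEw k (finsupp m1 `|` finsupp m2)%fset) ?mdomD //.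
rewrite (@shift_monEw k (finsupp m1 `|` finsupp m2)%fset m1) ?fsubsetUl //.
rewrite (@shift_monEw k (finsupp m1 `|` finsupp m2)%fset m2) ?fsubsetUr //.
by rewrite -big_split /=; apply: eq_bigr => x _; rewrite cmM exprD.
Qed.

HB.instance Definition _ k :=
  isMultiplicative.Build {cmonom dvar I} V (shift_mon k)
    (shift_mon_is_mmorphism k).

Let shift_mmap k : {rmorphism V -> V} :=
  mmap (@mkmalgU {cmonom dvar I} F mone) (shift_mon k).

Lemma shift_is_zmod_morphism k : zmod_morphism (shift k).
Proof. by rewrite unlock; exact: (raddfB (shift_mmap k)). Qed.

Lemma shift_is_monoid_morphism k : monoid_morphism (shift k).
Proof.
by rewrite unlock; split; [exact: (rmorph1 (shift_mmap k))
                          |exact: (rmorphM (shift_mmap k))].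
Qed.

Lemma shift_is_scalable k : scalable (shift k).
Proof. by move=> c p; rewrite unlock mmapZ mul_malgC. Qed.

HB.instance Definition _ k :=
  GRing.isZmodMorphism.Build V V (shift k) (shift_is_zmod_morphism k).
HB.instance Definition _ k :=
  GRing.isMonoidMorphism.Build V V (shift k) (shift_is_monoid_morphism k).
HB.instance Definition _ k :=
  GRing.isScalable.Build F V V *:%R (shift k) (shift_is_scalable k).

Lemma shiftX k (x : dvar I) : shift k (dX x) = dX (x.1, x.2 + k).
Proof.
rewrite unlock /dX mmapU /= mpolyC1E mul1r /shift_mon mdomU big_seq_fset1.
by rewrite cmUU expr1.
Qed.

Lemma monomE (m : {cmonom dvar I}) :
  << m >> = \prod_(x <- finsupp m) dX x ^+ m x :> V.
Proof.
have mE : m = \big[mmul/mone]_(x <- finsupp m) iter (m x) (mmul (ucm x)) mone.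
  apply/eqP/cmP => i.
  rewrite (big_morph (fun m : {cmonom dvar I} => m i)
             (fun m1 m2 => cmM i m1 m2) (cm1 i)).
  have itE (x : dvar I) n : iter n (mmul (ucm x)) mone i = ((x == i) * n)%N.
    by elim: n => [|n IHn] /=; rewrite ?cm1 ?muln0 // cmM IHn cmU mulnS.
  under eq_bigr do rewrite itE.
  case: (mdomP m i) => im.
    rewrite (big_fsetD1 i) //= eqxx mul1n big_seq_cond big1 ?addn0 // => x.
    by rewrite !inE andbT => /andP[/negPf -> _].
  rewrite big_seq big1 // => x xm.
  by case: eqVneq xm im => // -> ->.
have monM (m1 m2 : {cmonom dvar I}) :
    << mmul m1 m2 >> = << m1 >> * << m2 >> :> V.
  by rewrite malgM_def fgmulUU mulr1.
rewrite [in LHS]mE.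
rewrite (big_morph (fun m : {cmonom dvar I} => << m >> : V) monM (erefl _)).
apply: eq_bigr => x _; elim: (m x) => [|n IHn] //=.
by rewrite monM IHn exprS.
Qed.

Lemma diffpoly_ext (f g : {lrmorphism V -> V}) :
  (forall x, f (dX x) = g (dX x)) -> f =1 g.
Proof.
move=> fg p; rewrite (monalgE p) !raddf_sum; apply: eq_bigr => m _.
have -> : << p@_m *g m >> = p@_m *: << m >> :> V.
  by rewrite -mul_malgC malgM_def fgmulUU mulr1 mul1m.
rewrite /= !linearZ monomE !rmorph_prod /=; congr (_ *: _).
by apply: eq_bigr => x _; rewrite !rmorphXn /= fg.
Qed.

Lemma shiftD k l (p : V) : shift k (shift l p) = shift (l + k) p.
Proof.
apply: (@diffpoly_ext (shift k \o shift l) (shift (l + k))) => x /=.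
by rewrite (shiftX l) (shiftX k) (shiftX (l + k)) addrA.
Qed.

Lemma shift0 (p : V) : shift 0 p = p.
Proof.
apply: (@diffpoly_ext (shift 0) idfun) => x /=.
by rewrite shiftX addr0 -surjective_pairing.
Qed.

Lemma shiftK k : cancel (shift k) (shift (- k)).
Proof. by move=> p; rewrite shiftD subrr shift0. Qed.

Lemma shiftKV k : cancel (shift (- k)) (shift k).
Proof. by move=> p; rewrite shiftD addNr shift0. Qed.

Definition dshift : algAut V :=
  @AlgAut F V (shift 1) (shift (- 1)) (@shiftK 1) (@shiftKV 1).

Lemma autz_dshift (k : int) (p : V) : autz dshift k p = shift k p.
Proof.
case: k => k /=.
  elim: k => [|k IHk] /=; first by rewrite shift0.
  by rewrite IHk shiftD -addn1 PoszD.
rewrite NegzE; elim: k => [//|k IHk].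
by rewrite iterS IHk [LHS]shiftD -opprD -(addn1 k.+1) PoszD.
Qed.

End DiffPoly.

(* The index set of the variables u_i, i <= N - 1. *)
Definition idx (N : nat) : choiceType := {i : int | i <= N%:Z - 1}.

Section GenericL.
Variables (F : fieldType) (N : nat).
Local Notation V := (diffpoly F (idx N)).

(* u_i for every i : int, with the conventions u_N = 1 and u_i = 0 for i > N. *)
Definition gen (i : int) : V :=
  if (insub i : option (idx N)) is Some j then dX F (j, 0) else (i == N%:Z)%:R.

Definition genL : pdo V := PDO N%:Z (fun k => gen (N%:Z - k%:Z)).

Lemma symbol_genL (i : int) : symbol genL i = gen i.
Proof.
rewrite /symbol /=; case: leP => iN.
  by rewrite gez0_abs ?subr_ge0 // opprB addrC subrK.
rewrite /gen insubF ?gt_eqF //.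
by apply/negbTE; rewrite -ltNge (le_lt_trans _ iN) // gerBl.
Qed.

End GenericL.

Definition eps (i j : int) : int :=
  if (1 <= i) && (1 <= j) then 1
  else if (i <= 0) && (j <= 0) then -1 else 0.

(* eps_ij ((λS)^-i - λ^j) u_(i + j) *)
Definition bracket1 (F : fieldType) (N : nat) (i j : int) :
    laurent (diffpoly F (idx N)) :=
  (<< autz (dshift F (idx N)) (- i) (gen F N (i + j)) *g - i >>
    - << gen F N (i + j) *g j >>) *~ eps i j.

Definition hdens (F : fieldType) (N n : nat) : diffpoly F (idx N) :=
  - (n%:R^-1 *: mRes (pdo_exp (dshift F (idx N)) (genL F N) n)).

(* br is the structure of mPVA {._λ.}_1^(L) on V; its values on the generators
   determine it. *)
Definition isMPVA1 (F : fieldType) (N : nat)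
    (br : diffpoly F (idx N) -> diffpoly F (idx N)
            -> laurent (diffpoly F (idx N))) : Prop :=
  isMPVA (dshift F (idx N)) br /\
  (forall i j : int, i <= N%:Z - 1 -> j <= N%:Z - 1 ->
     br (gen F N i) (gen F N j) = bracket1 F N i j).

(* Main.v *)
(**
  L acts on sequences as the infinite matrix with entries S^a(u_(b - a)), and
  {S^n(a), b}, the coefficient of λ^n in {a_λ b}, is an S-invariant local
  Poisson bracket for which these entries satisfy the commutation relations of
  matrix units, with opposite signs on the strictly upper and on the lower
  triangular ones. Existence is the extension of this bracket from the
  variables to all difference polynomials. Conversely, cyclicity of the trace
  gives {Tr L^n, u_j} = n Tr (L^(n-1) {L, u_j}), which the relations turn into
  the two halves of [L^(n-1), L] = 0; hence the Lax equation. It propagates to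
  the powers of L, and residues of commutators lie in (S - 1) V: this is the
  involution property. Sending u_0 to 'X and the other u_i to 0 sends
  mRes L^n to 'X^n, whence linear independence.
*)
From HB Require Import structures.
Require Import Defs.
From mathcomp Require Import all_boot all_order all_algebra.
From mathcomp Require Import finmap.
From mathcomp Require Import zify ring.
From mathcomp.multinomials Require Import monalg.

Set Implicit Arguments.
Unset Strict Implicit.
Unset Printing Implicit Defensive.

Import Order.TTheory GRing.Theory Num.Theory.
Local Open Scope ring_scope.

Local Arguments autz : simpl never.

(** * Integer powers of the automorphism, and equality modulo total differences *)

Section Automorphism.
Variables (F : fieldType) (V : comAlgType F) (S : algAut V).

Lemma autz1D (n : int) (a : V) : autz S (1 + n) a = S (autz S n a).
Proof.
case: n => [n|[|n]]; [by []|by rewrite /autz /= autKV|].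
have -> : 1 + Negz n.+1 = Negz n by lia.
by rewrite /autz /= autKV.
Qed.

Lemma autzD (k l : int) (a : V) : autz S k (autz S l a) = autz S (k + l) a.
Proof.
elim/int_ind: k => [|k IHk|k IHk]; first by rewrite add0r.
  by rewrite -add1n PoszD autz1D IHk -autz1D addrA.
apply: (can_inj (autK S)); rewrite -!autz1D.
have -> : 1 + - k.+1%:Z = - k%:Z by lia.
by rewrite IHk; congr (autz S _ a); lia.
Qed.

Lemma autz_linear (k : int) : linear (autz S k).
Proof.
elim/int_ind: k => [|k IHk|k IHk] c a b; first by [].
  by rewrite -add1n PoszD !autz1D IHk linearP.
apply: (can_inj (autK S)); rewrite linearP /=.
rewrite -!autz1D.
have -> : 1 + - k.+1%:Z = - k%:Z by lia.
by rewrite IHk.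
Qed.

Lemma autz_monoid_morphism (k : int) : monoid_morphism (autz S k).
Proof.
elim/int_ind: k => [//|k [IH1 IHM]|k [IH1 IHM]].
  by split=> [|a b];
    rewrite -add1n PoszD !autz1D ?IH1 ?IHM ?rmorph1 ?rmorphM.
have kE : 1 + - k.+1%:Z = - k%:Z by lia.
split=> [|a b]; apply: (can_inj (autK S)).
  by rewrite rmorph1 /= -autz1D kE IH1.
by rewrite rmorphM /= -!autz1D kE IHM.
Qed.

HB.instance Definition _ k :=
  GRing.isLinear.Build F V V *:%R (autz S k) (autz_linear k).
HB.instance Definition _ k :=
  GRing.isMonoidMorphism.Build V V (autz S k) (autz_monoid_morphism k).

Lemma autz_commute (D : V -> V) (k : int) :
  (forall a, D (S a) = S (D a)) -> {morph D : a / autz S k a}.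
Proof.
move=> DS; elim/int_ind: k => [//|k IHk|k IHk] a.
  by rewrite -add1n PoszD !autz1D DS IHk.
apply: (can_inj (autK S)); rewrite -DS -!autz1D.
have -> : 1 + - k.+1%:Z = - k%:Z by lia.
exact: IHk.
Qed.

(** Telescoping: the witness is the sum of the [autz S j a] over 0 <= j < k, or minus the sum over k
    <= j < 0 when k is negative. *)
Lemma eq_int_autz (k : int) (a : V) : eq_int S (autz S k a) a.
Proof.
elim/int_ind: k => [|k [c kc]|k [c kc]].
- by exists 0; rewrite /= rmorph0 !subrr.
- exists (autz S k a + c); rewrite -add1n PoszD autz1D rmorphD /=.
  by rewrite (canRL (subrK _) (esym kc)); ring.
- exists (c - autz S (- k.+1%:Z) a); rewrite rmorphB /= -autz1D.
  have -> : 1 + - k.+1%:Z = - k%:Z by lia.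
  by rewrite (canRL (subrK _) (esym kc)); ring.
Qed.

Lemma eq_int_sum (J : Type) (r : seq J) (a b : J -> V) :
  (forall j, eq_int S (a j) (b j)) ->
  eq_int S (\sum_(j <- r) a j) (\sum_(j <- r) b j).
Proof.
move=> ab; elim: r => [|j r [c rc]].
  by exists 0; rewrite !big_nil rmorph0.
have [c' jc] := ab j; exists (c' + c).
by rewrite !big_cons rmorphD opprD addrACA jc rc; ring.
Qed.

Lemma eq_int_subr0 (a b : V) : eq_int S a b -> eq_int S (a - b) 0.
Proof. by case=> c abc; exists c; rewrite subr0. Qed.

Lemma eq_int0Z (x : F) (a : V) : eq_int S a 0 -> eq_int S (x *: a) 0.
Proof.
case=> c; rewrite subr0 => ->; exists (x *: c).
by rewrite subr0 linearZ scalerBr.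
Qed.

End Automorphism.

(** * Reindexing of convolution sums over two and three indices *)

Section BigTriangle.
Variables (V : nmodType).

(** Replaces a dependent range by the symmetric condition i + j = k on a fixed square, where indices
    can be exchanged freely. *)
Lemma big_split_index (k : nat) (G : nat -> nat -> V) (K : nat) : (k < K)%N ->
  \sum_(i < k.+1) G i (k - i)%N
    = \sum_(i < K) \sum_(j < K | (i + j == k)%N) G i j.
Proof.
move=> kK; rewrite (big_ord_widen K (fun i => G i (k - i)%N)) // big_mkcond /=.
apply: eq_bigr => i _; case: ltnP => ik.
  have jK : (k - i < K)%N by lia.
  rewrite (big_pred1 (Ordinal jK)) // => j.
by rewrite /= -(inj_eq val_inj) /=; lia.
by rewrite big_pred0 // => j; lia.
Qed.

Lemma big_split_index3r (k : nat) (G : nat -> nat -> nat -> V) :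
  \sum_(i < k.+1) \sum_(j < (k - i).+1) G i j (k - i - j)%N
    = \sum_(i < k.+1) \sum_(j < k.+1) \sum_(l < k.+1 | (i + j + l == k)%N)
        G i j l.
Proof.
apply: eq_bigr => i _.
rewrite (@big_split_index (k - i) (G i) k.+1) ?ltnS ?leq_subr //.
apply: eq_bigr => j _; apply: eq_bigl => l.
by have := ltn_ord i; lia.
Qed.

Lemma big_split_index3l (k : nat) (G : nat -> nat -> nat -> V) :
  \sum_(m < k.+1) \sum_(i < m.+1) G i (m - i)%N (k - m)%N
    = \sum_(i < k.+1) \sum_(j < k.+1) \sum_(l < k.+1 | (i + j + l == k)%N)
        G i j l.
Proof.
under eq_bigr => m _.
  rewrite (@big_split_index m (fun i j => G i j (k - m)%N) k.+1) //.
over.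
rewrite exchange_big; apply: eq_bigr => i _ /=.
rewrite (exchange_big_dep predT) //=; apply: eq_bigr => j _.
have [ijk|ijk] := leqP (i + j) k; last first.
  rewrite !big_pred0 // => l; have := ltn_ord l; lia.
have mK : (i + j < k.+1)%N by lia.
have lK : (k - (i + j) < k.+1)%N by lia.
rewrite (big_pred1 (Ordinal mK)) => [|m]; last first.
  by rewrite /= -(inj_eq val_inj) /= eq_sym.
rewrite (big_pred1 (Ordinal lK)) // => l.
by rewrite /= -(inj_eq val_inj) /=; lia.
Qed.

(** The third index is regrouped with the first: at the level of indices, this is the passage from A
    (B C) to (C A) B needed for the cyclicity of the trace. *)
Lemma big_split_index3_rot (k : nat) (G : nat -> nat -> nat -> V) :
  \sum_(i < k.+1) \sum_(j < (k - i).+1) G i j (k - i - j)%N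
    = \sum_(m < k.+1) \sum_(l < m.+1) G (m - l)%N (k - m)%N l.
Proof.
rewrite big_split_index3r (@big_split_index3l k (fun l i j => G i j l)).
under eq_bigr do under eq_bigr do rewrite big_mkcond.
under eq_bigr do rewrite exchange_big.
rewrite exchange_big; apply: eq_bigr => l _; apply: eq_bigr => i _.
rewrite [RHS]big_mkcond; apply: eq_bigr => j _ /=.
by have -> : (i + j + l = l + i + j)%N by lia.
Qed.

End BigTriangle.

(** * Products and powers of pseudodifference operators, as coefficient sequences *)

Section TwistedProduct.
Variables (F : fieldType) (V : comAlgType F) (S : algAut V).

(* If a and b are the coefficient sequences, from the top, of operators of
   degrees d and e, then tw d a b is that of their product, of degree d + e. *)
Definition tw (d : int) (a b : nat -> V) (k : nat) : V :=
  \sum_(i < k.+1) a i * autz S (d - (i : nat)%:Z) (b (k - i)%N).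

Lemma eq_tw d (a a' b b' : nat -> V) :
  a =1 a' -> b =1 b' -> tw d a b =1 tw d a' b'.
Proof. by move=> aa bb k; apply: eq_bigr => i _; rewrite aa bb. Qed.

(** Both bracketings expand to the sum of the same terms [G i j l] over i + j + l = k. *)
Lemma twA (d e : int) (a b c : nat -> V) :
  tw d a (tw e b c) =1 tw (d + e) (tw d a b) c.
Proof.
move=> k; pose G i j l :=
  a i * autz S (d - i%:Z) (b j) * autz S (d + e - i%:Z - j%:Z) (c l).
transitivity (\sum_(i < k.+1) \sum_(j < (k - i).+1) G i j (k - i - j)%N).
  apply: eq_bigr => i _; rewrite /tw raddf_sum big_distrr.
  apply: eq_bigr => j _ /=; rewrite rmorphM /= autzD mulrA /G.
  by congr (_ * autz S _ _); ring.
rewrite big_split_index3r -big_split_index3l.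
apply: eq_bigr => m _; rewrite /tw big_distrl; apply: eq_bigr => i _ /=.
by rewrite /G; congr (_ * autz S _ _); have := ltn_ord i; lia.
Qed.

Lemma twBl d (a a' b : nat -> V) k :
  tw d (fun i => a i - a' i) b k = tw d a b k - tw d a' b k.
Proof. by rewrite /tw -sumrB; apply: eq_bigr => i _; rewrite mulrBl. Qed.

Lemma twBr d (a b b' : nat -> V) k :
  tw d a (fun i => b i - b' i) k = tw d a b k - tw d a b' k.
Proof. by rewrite /tw -sumrB; apply: eq_bigr => i _; rewrite raddfB mulrBr. Qed.

Definition tw_one (k : nat) : V := (k == 0)%:R.

Lemma tw1l (b : nat -> V) : tw 0 tw_one b =1 b.
Proof.
move=> k; rewrite /tw big_ord_recl big1 => [|i _]; last by rewrite mul0r.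
by rewrite addr0 subn0 mul1r.
Qed.

Lemma tw1r d (a : nat -> V) : tw d a tw_one =1 a.
Proof.
move=> k; rewrite /tw big_ord_recr big1 => [|i _] /=.
  by rewrite add0r subnn rmorph1 mulr1.
by rewrite /tw_one subn_eq0 leqNgt ltn_ord rmorph0 mulr0.
Qed.

(** A vanishing leading coefficient: the same operator, presented with its degree raised by one. *)
Definition pad1 (a : nat -> V) (k : nat) : V := if k is k'.+1 then a k' else 0.

Lemma tw_pad1l d a b : tw (d + 1) (pad1 a) b =1 pad1 (tw d a b).
Proof.
case=> [|k]; first by rewrite /tw big_ord1 mul0r.
rewrite /tw big_ord_recl mul0r add0r; apply: eq_bigr => i _ /=.
by rewrite subSS /bump; congr (_ * autz S _ _); lia.
Qed.

Lemma tw_pad1r d a b : tw d a (pad1 b) =1 pad1 (tw d a b).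
Proof.
case=> [|k]; first by rewrite /tw big_ord1 rmorph0 mulr0.
rewrite /tw big_ord_recr subnn /= rmorph0 mulr0 addr0; apply: eq_bigr => i _.
by rewrite /= subSn // -ltnS.
Qed.

Definition pad (n : nat) (a : nat -> V) : nat -> V := iter n pad1 a.

Lemma eq_pad1 (a b : nat -> V) : a =1 b -> pad1 a =1 pad1 b.
Proof. by move=> ab [|k] /=. Qed.

Lemma eq_pad n (a b : nat -> V) : a =1 b -> pad n a =1 pad n b.
Proof. by move=> ab; elim: n => //= n IHn; apply: eq_pad1. Qed.

Lemma padD n (a : nat -> V) k : pad n a (n + k) = a k.
Proof. by elim: n. Qed.

Lemma pad_lt n (a : nat -> V) k : (k < n)%N -> pad n a k = 0.
Proof. by elim: n k => [|n IHn] [|k] //=; apply: IHn. Qed.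

Lemma tw_padl n d a b : tw (d + n%:Z) (pad n a) b =1 pad n (tw d a b).
Proof.
elim: n => [|n IHn] k; first by rewrite addr0.
rewrite -addn1 PoszD addrA addn1 /= -/(pad n a) tw_pad1l.
exact: eq_pad1.
Qed.

Lemma tw_padr n d a b : tw d a (pad n b) =1 pad n (tw d a b).
Proof.
elim: n => [|n IHn] k //=.
by rewrite -/(pad n b) tw_pad1r; apply: eq_pad1.
Qed.

Lemma padDr n (a b : nat -> V) k :
  pad n (fun i => a i + b i) k = pad n a k + pad n b k.
Proof. by elim: n k => [|n IHn] [|k] //=; rewrite addr0. Qed.

Lemma pad_eq0 n (a : nat -> V) : (forall k, a k = 0) -> forall k, pad n a k = 0.
Proof. by move=> a0; elim: n => [|n IHn] [|k] //=. Qed.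

Section Derivation.
Variable D : V -> V.
Hypothesis D_add : {morph D : a b / a + b}.
Hypothesis (D_mul : forall a b, D (a * b) = D a * b + a * D b).
Hypothesis D_S : forall a, D (S a) = S (D a).

Lemma der0 : D 0 = 0.
Proof. by apply: (addrI (D 0)); rewrite -D_add !addr0. Qed.

Lemma der1 : D 1 = 0.
Proof.
by apply: (addrI (D 1)); rewrite -[in RHS](mulr1 1) D_mul mulr1 mul1r addr0.
Qed.

Lemma der_tw d (a b : nat -> V) k :
  D (tw d a b k) = tw d (D \o a) b k + tw d a (D \o b) k.
Proof.
rewrite /tw -big_split /= (big_morph D D_add der0); apply: eq_bigr => i _.
by rewrite D_mul (autz_commute _ D_S).
Qed.

End Derivation.

(* Residues of commutators are total differences: with
   y = c autz (i - d) p, the terms of the two sums differ by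
   autz (d - i) y - y. *)
Lemma eq_int_tw_comm (d e : int) (a b : nat -> V) (k : nat) :
  d + e = k%:Z -> eq_int S (tw d a b k) (tw e b a k).
Proof.
move=> dek; rewrite /tw [X in eq_int S _ X](reindex_inj rev_ord_inj) /=.
apply: eq_int_sum => i; rewrite /= subSS.
have ik : (i <= k)%N by rewrite -ltnS.
rewrite (subKn ik); set y := (X in eq_int S _ X).
have -> : a i * autz S (d - (i : nat)%:Z) (b (k - i)%N)
            = autz S (d - (i : nat)%:Z) y.
  rewrite rmorphM /= autzD mulrC; congr (_ * _).
  by have -> : d - (i : nat)%:Z + (e - (k - i)%N%:Z) = 0 by lia.
exact: eq_int_autz.
Qed.

Variables (N : nat) (g : nat -> V).

(** Coefficients of L^n in degree n N, where L has degree N and coefficients [g]. *)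
Fixpoint tw_exp (n : nat) : nat -> V :=
  if n is n'.+1 then tw N%:Z g (tw_exp n') else tw_one.

Lemma tw_expD m n : tw (m * N)%N%:Z (tw_exp m) (tw_exp n) =1 tw_exp (m + n).
Proof.
elim: m => [|m IHm] k; first by rewrite mul0n tw1l.
rewrite addSn /= -(eq_tw _ (fun _ => erefl) IHm) twA mulSn PoszD.
by [].
Qed.

Lemma tw_exp1 : tw_exp 1 =1 g.
Proof. exact: tw1r. Qed.

(** The recursion multiplies by L on the left; multiplying on the right gives the same power, which
    amounts to [L^n, L] = 0. *)
Lemma tw_expSr n : tw (n * N)%N%:Z (tw_exp n) g =1 tw_exp n.+1.
Proof.
move=> k; rewrite -addn1 -tw_expD.
by apply: eq_tw => // i; rewrite tw_exp1.
Qed.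

(* D L = [P, L] implies D L^n = [P, L^n]; the padding aligns the leading
   coefficients of D L^n and of the commutator, whose degree is larger by d. *)
Lemma der_tw_exp (D : V -> V) (d : nat) (p : nat -> V) :
  {morph D : a b / a + b} ->
  (forall a b, D (a * b) = D a * b + a * D b) ->
  (forall a, D (S a) = S (D a)) ->
  (forall t, pad d (D \o g) t = tw d%:Z p g t - tw N%:Z g p t) ->
  forall n t, pad d (D \o tw_exp n) t
    = tw d%:Z p (tw_exp n) t - tw (n * N)%N%:Z (tw_exp n) p t.
Proof.
move=> D_add D_mul D_S Dg; elim=> [|n IHn] t.
  rewrite mul0n tw1l tw1r subrr; apply: pad_eq0 => k /=.
  by rewrite /tw_one; case: (k == 0); rewrite ?der0 ?der1.
rewrite (eq_pad d (der_tw D_add D_mul D_S N%:Z g (tw_exp n))) padDr.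
rewrite -tw_padl -tw_padr (eq_tw _ Dg (fun _ => erefl)).
(* What remains is [P, L] L^n + L [P, L^n] = [P, L^(n+1)], where the two terms L P L^n cancel. *)
rewrite (eq_tw _ (fun _ => erefl) IHn) twBl twBr -!twA.
by rewrite mulSn PoszD [N%:Z + d%:Z]addrC -!twA; ring.
Qed.

End TwistedProduct.

(** * Consequences of the bracket axioms, and evaluation at λ = 1 *)

Section BracketAtOne.
Variables (F : fieldType) (V : comAlgType F) (S : algAut V).
Variable br : V -> V -> laurent V.
Hypothesis br_mpva : isMPVA S br.

(* p evaluated at λ = S, acting on f. *)
Definition pair (f : V) (p : laurent V) : V :=
  \sum_(n <- msupp p) autz S n f * p@_n.

Lemma pairEw f (p : laurent V) (r : seq int) :
  uniq r -> {subset msupp p <= r} -> pair f p = \sum_(n <- r) autz S n f * p@_n.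
Proof.
move=> r_uniq pr; rewrite [RHS](bigID (mem (msupp p))) /=.
rewrite [X in _ + X]big1 ?addr0 => [|n]; last first.
  by move/mcoeff_outdom ->; rewrite mulr0.
rewrite -big_filter; apply: perm_big; apply: uniq_perm => [||n].
- exact: fset_uniq.
- exact: filter_uniq.
by rewrite mem_filter /=; case: (boolP (n \in msupp p)) => // /pr ->.
Qed.

Lemma pair1 p : pair 1 p = laurent_at1 p.
Proof. by apply: eq_bigr => n _; rewrite rmorph1 mul1r. Qed.

Lemma pair_additive f : additive (pair f).
Proof.
move=> p q; pose r := (msupp p `|` msupp q)%fset.
rewrite !(@pairEw f _ r) ?fset_uniq //.
- by rewrite -sumrB; apply: eq_bigr => n _; rewrite mcoeffB mulrBr.
- by move=> n qn; rewrite inE qn orbT.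
- by move=> n pn; rewrite inE pn.
by apply/fsubsetP/msuppB_le.
Qed.

HB.instance Definition _ f :=
  GRing.isZmodMorphism.Build (laurent V) V (pair f) (pair_additive f).

Lemma pairU f c n : pair f << c *g n >> = autz S n f * c.
Proof.
rewrite (@pairEw _ _ [:: n]) ?big_seq1 ?mcoeffUU // => m.
by move/(fsubsetP msuppU_le); rewrite in_fset1 inE.
Qed.

Lemma brDl a a' b : br (a + a') b = br a b + br a' b.
Proof.
apply/malgP => n; rewrite mcoeffD -[a]scale1r (mpva_linearl br_mpva).
by rewrite !scale1r.
Qed.

Lemma br0l b : br 0 b = 0.
Proof. by apply: (addrI (br 0 b)); rewrite -brDl !addr0. Qed.

Lemma brZl x a b n : (br (x *: a) b)@_n = x *: (br a b)@_n.
Proof.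
by rewrite -[_ *: a]addr0 (mpva_linearl br_mpva) br0l mcoeff0 addr0.
Qed.

Lemma brDr a b b' : br a (b + b') = br a b + br a b'.
Proof.
apply/malgP => n; rewrite mcoeffD -[b]scale1r (mpva_linearr br_mpva).
by rewrite !scale1r.
Qed.

Lemma br0r a : br a 0 = 0.
Proof. by apply: (addrI (br a 0)); rewrite -brDr !addr0. Qed.

Lemma brZr x a b n : (br a (x *: b))@_n = x *: (br a b)@_n.
Proof.
by rewrite -[_ *: b]addr0 (mpva_linearr br_mpva) br0r mcoeff0 addr0.
Qed.

Lemma br1l b : br 1 b = 0.
Proof.
apply/malgP => n; apply: (addrI (br 1 b)@_n); rewrite mcoeff0 addr0.
by rewrite -[in RHS](mulr1 1) (mpva_leibnizl br_mpva) !rmorph1 !mulr1.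
Qed.

Lemma br1r a : br a 1 = 0.
Proof.
apply/malgP => n; apply: (addrI (br a 1)@_n); rewrite mcoeff0 addr0.
by rewrite -[in RHS](mulr1 1) (mpva_leibnizr br_mpva) !mulr1.
Qed.

Lemma br_autzl k a b n : (br (autz S k a) b)@_n = (br a b)@_(n + k).
Proof.
elim/int_ind: k n => [|k IHk|k IHk] n; first by rewrite addr0.
  rewrite -add1n PoszD autz1D (mpva_sesquil br_mpva) IHk addrA.
  by [].
rewrite -(subrK 1 n) -(mpva_sesquil br_mpva) -autz1D.
have -> : 1 + - k.+1%:Z = - k%:Z by lia.
by rewrite IHk; congr (_@__); lia.
Qed.

(** * The trace of A {B, x} for a fixed element x, and its cyclicity *)

Section Omega.
Variable x : V.

(** In the notation {S^n(a), x} for the coefficients, this is the sum over n of S^n(f) {S^n(a), x}: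
    the weight is shifted along with the differentiated element. The weight f = 1 gives {∫a, x}. *)
Definition omega (f a : V) : V := pair f (br a x).

Lemma omegaDl f f' a : omega (f + f') a = omega f a + omega f' a.
Proof.
by rewrite -big_split; apply: eq_bigr => n _ /=; rewrite raddfD mulrDl.
Qed.

Lemma omega0l a : omega 0 a = 0.
Proof. by apply: big1 => n _; rewrite raddf0 mul0r. Qed.

Lemma omegaDr f a a' : omega f (a + a') = omega f a + omega f a'.
Proof. by rewrite /omega brDl raddfD. Qed.

Lemma omega0r f : omega f 0 = 0.
Proof. by apply: (addrI (omega f 0)); rewrite -omegaDr !addr0. Qed.

Lemma omegaM f a b : omega f (a * b) = omega (f * b) a + omega (f * a) b.
Proof.
pose r := (msupp (br (a * b) x) `|` (msupp (br a x) `|` msupp (br b x)))%fset.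
rewrite /omega !(@pairEw _ _ r) ?fset_uniq //.
- rewrite -big_split; apply: eq_bigr => n _ /=.
  by rewrite (mpva_leibnizl br_mpva) !rmorphM /=; ring.
- by move=> n pn; rewrite !inE pn !orbT.
- by move=> n pn; rewrite !inE pn !orbT.
by move=> n pn; rewrite !inE pn.
Qed.

Lemma omegaZr f c a : omega f (c *: a) = c *: omega f a.
Proof.
rewrite /omega (@pairEw _ _ (msupp (br a x))) ?fset_uniq //.
  by rewrite scaler_sumr; apply: eq_bigr => n _; rewrite brZl -scalerAr.
move=> n; rewrite -!mcoeff_neq0 brZl.
by apply: contraNneq => ->; rewrite scaler0.
Qed.

Lemma omega1r f : omega f 1 = 0.
Proof.
by apply: (addrI (omega f 1)); rewrite -[in RHS](mulr1 1) omegaM !mulr1 addr0.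
Qed.

(** A common shift of the weight and of the differentiated element only translates the summation
    index, so a shift of one can be undone on the other. *)
Lemma omega_autz f k a : omega f (autz S k a) = omega (autz S (- k) f) a.
Proof.
rewrite /omega.
rewrite (@pairEw _ (br a x) [seq n + k | n <- msupp (br (autz S k a) x)]).
- rewrite big_map; apply: eq_bigr => n _.
  by rewrite br_autzl autzD addrK.
- by rewrite map_inj_uniq ?fset_uniq //; apply: addIr.
move=> n n_supp; apply/mapP; exists (n - k); last by rewrite subrK.
by rewrite -mcoeff_neq0 br_autzl subrK mcoeff_neq0.
Qed.

(* The trace of A \circ {B, x} for operators A and B with coefficient sequences
   a, b and of total degree k; d is the degree of A. *)
Definition Om (d : int) (a b : nat -> V) (k : nat) : V :=
  \sum_(i < k.+1) omega (a i) (autz S (d - (i : nat)%:Z) (b (k - i)%N)).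

Lemma eq_Om d a a' b b' k : a =1 a' -> b =1 b' -> Om d a b k = Om d a' b' k.
Proof. by move=> aa bb; apply: eq_bigr => i _; rewrite aa bb. Qed.

Lemma Om_tw_one d a k : Om d a (tw_one V) k = 0.
Proof.
apply: big1 => i _; rewrite /tw_one.
by case: (_ == _); rewrite ?rmorph0 ?rmorph1 (omega0r, omega1r).
Qed.

Lemma Om_one_tw b k : Om 0 (tw_one V) b k = omega 1 (b k).
Proof.
rewrite /Om big_ord_recl big1 => [|i _]; last by rewrite omega0l.
by rewrite addr0 subn0.
Qed.

(** Leibniz rule and cyclicity: Tr A {B C, x} = Tr A B {C, x} + Tr C A {B, x}. The assumption on the
    degrees says that the coefficient taken is the residue, the only one for which the rotation is
    legitimate. *)
Lemma Om_tw (d e f : int) (a b c : nat -> V) (k : nat) : d + e + f = k%:Z ->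
  Om d a (tw S e b c) k
    = Om (d + e) (tw S d a b) c k + Om (f + d) (tw S f c a) b k.
Proof.
move=> defk.
(* In [G1] the factor from C is differentiated, in [G2] the one from B; the other factor joins the
   weight. *)
pose G1 i j l := omega (a i * autz S (d - i%:Z) (b j))
                       (autz S (d + e - i%:Z - j%:Z) (c l)).
pose G2 i j l := omega (a i * autz S (d + e - i%:Z - j%:Z) (c l))
                       (autz S (d - i%:Z) (b j)).
have omega_suml g J (r : seq J) (G : J -> V) :
    omega (\sum_(j <- r) G j) g = \sum_(j <- r) omega (G j) g.
  exact: (big_morph (omega^~ g) (fun f f' => omegaDl f f' g) (omega0l g)).
transitivity (\sum_(i < k.+1) \sum_(j < (k - i).+1) G1 i j (k - i - j)%N
              + \sum_(i < k.+1) \sum_(j < (k - i).+1) G2 i j (k - i - j)%N).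
  rewrite -big_split; apply: eq_bigr => i _ /=.
  rewrite -big_split /tw raddf_sum.
  rewrite (big_morph _ (omegaDr _) (omega0r _)); apply: eq_bigr => j _ /=.
  rewrite rmorphM /= autzD omegaM addrC /G1 /G2.
  by have -> : d - (i : nat)%:Z + (e - (j : nat)%:Z)
       = d + e - (i : nat)%:Z - (j : nat)%:Z by ring.
congr (_ + _).
  rewrite big_split_index3r -big_split_index3l; apply: eq_bigr => m _.
  rewrite /tw omega_suml; apply: eq_bigr => i _; rewrite /G1.
  by congr (omega _ (autz S _ _)); have := ltn_ord i; lia.
(* The coefficient of C has to come first: the indices are rotated and [omega_autz] moves all shifts
   into the weight, where they agree because d + e + f = k. *)
rewrite big_split_index3_rot; apply: eq_bigr => m _.
rewrite /tw omega_suml; apply: eq_bigr => l _; rewrite /G2 !omega_autz.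
rewrite !rmorphM /= !autzD mulrC.
by congr (omega (autz S _ _ * autz S _ _) _);
  have := ltn_ord l; have := ltn_ord m; lia.
Qed.

Variables (N : nat) (g : nat -> V).
Local Notation tw_exp := (tw_exp S N g).

(** Tr L^m {L^(n+1), x} = (n+1) Tr L^(m+n) {L, x}. The exponent [m] is general because each
    induction step moves one factor L from the differentiated power to the weight. *)
Lemma Om_tw_exp m n :
  Om (m * N)%N%:Z (tw_exp m) (tw_exp n.+1) ((m + n.+1) * N)%N
    = Om ((m + n) * N)%N%:Z (tw_exp (m + n)) g ((m + n.+1) * N)%N *+ n.+1.
Proof.
elim: n m => [|n IHn] m.
  rewrite (@Om_tw _ N%:Z 0) ?Om_tw_one; last by rewrite addn1 mulSn; lia.
  rewrite !add0r addn0.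
  by apply: eq_Om => // i; rewrite tw1l.
rewrite [tw_exp n.+2]/(tw S N%:Z g (tw_exp n.+1)).
rewrite (@Om_tw _ N%:Z (n.+1 * N)%N%:Z); last by lia.
rewrite mulrSr; congr (_ + _).
  have -> : (m * N)%N%:Z + N%:Z = (m.+1 * N)%N%:Z by rewrite -PoszD mulSn addnC.
  rewrite (addnS m n.+1) -addSn.
  rewrite (@eq_Om _ _ (tw_exp m.+1) _ (tw_exp n.+1)) //; last exact: tw_expSr.
  by rewrite IHn addSnnS.
have -> : (n.+1 * N)%N%:Z + (m * N)%N%:Z = ((m + n.+1) * N)%N%:Z.
  by rewrite -PoszD -mulnDl addnC.
by apply: eq_Om => // i; rewrite tw_expD addnC.
Qed.

Lemma omega_res_tw_exp n :
  omega 1 (tw_exp n.+1 (n.+1 * N)%N)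
    = Om (n * N)%N%:Z (tw_exp n) g (n.+1 * N)%N *+ n.+1.
Proof. by rewrite -Om_one_tw; exact: (Om_tw_exp 0). Qed.

End Omega.

(** * {∫h, .} as a derivation commuting with S *)

Section HamAction.
Variable h : V.
Local Notation D := (ham_action br h).

Lemma ham_actionE x : D x = omega x 1 h.
Proof. by rewrite /omega pair1. Qed.

Lemma ham_actionD : {morph D : a b / a + b}.
Proof. by move=> a b; rewrite /ham_action -!pair1 brDr raddfD. Qed.

Lemma ham_actionZ c a : D (c *: a) = c *: D a.
Proof.
rewrite /ham_action -!pair1 (@pairEw _ _ (msupp (br h a))) ?fset_uniq //.
  by rewrite scaler_sumr; apply: eq_bigr => n _; rewrite brZr -scalerAr.
move=> n; rewrite -!mcoeff_neq0 brZr.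
by apply: contraNneq => ->; rewrite scaler0.
Qed.

Lemma ham_actionM a b : D (a * b) = D a * b + a * D b.
Proof.
pose r := (msupp (br h (a * b)) `|` (msupp (br h a) `|` msupp (br h b)))%fset.
rewrite /ham_action -!pair1 !(@pairEw _ _ r) ?fset_uniq //.
- rewrite big_distrl big_distrr -big_split; apply: eq_bigr => n _ /=.
  by rewrite (mpva_leibnizr br_mpva); ring.
- by move=> n pn; rewrite !inE pn !orbT.
- by move=> n pn; rewrite !inE pn !orbT.
by move=> n pn; rewrite !inE pn.
Qed.

Lemma ham_actionS a : D (S a) = S (D a).
Proof.
rewrite /ham_action -!pair1 (@pairEw _ _ [seq n + 1 | n <- msupp (br h a)]).
- rewrite big_map rmorph_sum; apply: eq_bigr => n _ /=.
  by rewrite (mpva_sesquir br_mpva) addrK !rmorph1 !mul1r.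
- by rewrite map_inj_uniq ?fset_uniq //; apply: addIr.
move=> n; rewrite -mcoeff_neq0 (mpva_sesquir br_mpva) => Dn.
apply/mapP; exists (n - 1); last by rewrite subrK.
by rewrite -mcoeff_neq0; apply: contraNneq Dn => ->; rewrite rmorph0.
Qed.

End HamAction.

End BracketAtOne.

(** * Poisson brackets from their values on free generators *)

Section Poisson.
Variables (F : fieldType) (V : comAlgType F).

Definition derivation (D : V -> V) : Prop :=
  linear D /\ forall a b, D (a * b) = D a * b + a * D b.

Lemma derivation1 D : derivation D -> D 1 = 0.
Proof.
case=> _ DM; apply: (addrI (D 1)).
by rewrite -[in RHS](mulr1 1) DM mulr1 mul1r addr0.
Qed.

(** An induction principle with values in [Type], so that it can also produce data, such as the
    bounds in [local]. *)
Definition generates (J : Type) (X : J -> V) : Type :=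
  forall P : V -> Type,
  P 1 -> (forall x, P (X x)) -> (forall a b, P a -> P b -> P (a * b)) ->
  (forall (c : F) a b, P a -> P b -> P (c *: a + b)) -> forall a, P a.

(* The dual-number trick: p |-> p + D p 'X mod 'X^2 is multiplicative. *)
Lemma dual_number_derivation (J : Type) (X d : J -> V)
    (phi : {rmorphism V -> {poly V}}) : generates X ->
  (forall c a, phi (c *: a) = (c%:A)%:P * phi a) ->
  (forall x, phi (X x) = (X x)%:P + d x *: 'X) ->
  {D : V -> V | derivation D /\ forall x, D (X x) = d x}.
Proof.
move=> V_rect phiZ phiX.
have phi0 a : (phi a)`_0 = a.
  elim/V_rect: a => [|x|a b IHa IHb|c a b IHa IHb].
  - by rewrite rmorph1 coef1.
  - by rewrite phiX coefD coefC coefZ coefX mulr0 addr0.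
  - by rewrite rmorphM coef0M IHa IHb.
  by rewrite rmorphD coefD phiZ coefCM IHa IHb mulr_algl.
exists (fun a => (phi a)`_1); split; last first.
  by move=> x; rewrite phiX coefD coefC coefZ coefX mulr1 add0r.
split=> [c a b|a b]; first by rewrite rmorphD coefD phiZ coefCM mulr_algl.
rewrite rmorphM coefM !big_ord_recl big_ord0 /= subn0 subnn !phi0.
by rewrite addr0 addrC.
Qed.

Lemma derivation_lin (a b : V) D D' : derivation D -> derivation D' ->
  derivation (fun x => a * D x + b * D' x).
Proof.
move=> [DL DM] [DL' DM']; split=> [c x y|x y]; last by rewrite DM DM'; ring.
by rewrite DL DL' !mulrDr scalerDr -!scalerAr addrACA.
Qed.

Lemma derivation_comm D D' : derivation D -> derivation D' ->
  derivation (fun x => D (D' x) - D' (D x)).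
Proof.
move=> derD derD'; have [DL DM] := derD; have [DL' DM'] := derD'.
have DD x y : D (x + y) = D x + D y by rewrite -[x]scale1r DL !scale1r.
have DD' x y : D' (x + y) = D' x + D' y by rewrite -[x]scale1r DL' !scale1r.
split=> [c x y|x y].
  by rewrite DL' DL DL DL' scalerBr opprD addrACA.
by rewrite DM DM' DD DD' !DM !DM'; ring.
Qed.

Definition extends_to_derivations (J : Type) (X : J -> V) : Type :=
  forall d : J -> V, {D : V -> V | derivation D /\ forall x, D (X x) = d x}.

Variables (J : Type) (X : J -> V).
Hypotheses (V_rect : generates X) (V_der : extends_to_derivations X).

Lemma derivation_ext D D' : derivation D -> derivation D' ->
  (forall x, D (X x) = D' (X x)) -> D =1 D'.
Proof.
move=> derD derD' DX; elim/V_rect=> [|//|a b Da Db|c a b Da Db].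
- by rewrite !derivation1.
- by rewrite derD.2 derD'.2 Da Db.
by rewrite derD.1 derD'.1 Da Db.
Qed.

Variables (S : algAut V) (tau : int -> J -> J).
Hypothesis autz_X : forall k v, autz S k (X v) = X (tau k v).
Variable pi : J -> J -> V.
Hypothesis pi_skew : forall v w, pi v w = - pi w v.

Let der (d : J -> V) : V -> V := sval (V_der d).
Let derP d : derivation (der d) := (proj2_sig (V_der d)).1.
Let derX d x : der d (X x) = d x := (proj2_sig (V_der d)).2 x.

(** [der (pi w)] is {X w, .}, so its opposite at a is the required value {a, X w}; these values are
    extended as a derivation in the second argument. *)
Definition poisson (a b : V) : V := der (fun w => - der (pi w) a) b.
Local Notation pb := poisson.

Lemma poissonX v w : pb (X v) (X w) = pi v w.
Proof. by rewrite /poisson !derX -pi_skew. Qed.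

Lemma poisson_derr a : derivation (pb a).
Proof. exact: derP. Qed.

(** By construction only the second argument is known to act by derivations. Uniqueness of
    derivations with given values on generators yields the same for the first one, and then
    skew-symmetry follows from its case on generators. *)
Lemma poisson_skew a b : pb a b = - pb b a.
Proof.
have X_pb v c : pb (X v) c = der (pi v) c.
  apply: derivation_ext => // [|w]; first exact: poisson_derr.
  by rewrite poissonX derX.
have derl c : derivation (fun a => pb a c).
  split=> [x p q|p q].
    pose D y := x%:A * pb p y + 1 * pb q y.
    transitivity (D c); last by rewrite /D mulr_algl mul1r.
    apply: derivation_ext; [exact: poisson_derr| |move=> w].
      by apply: derivation_lin; apply: poisson_derr.
    by rewrite /D /poisson !derX (derP _).1 mulr_algl mul1r opprD scalerN.
  pose D y := q * pb p y + p * pb q y.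
  transitivity (D c); last by rewrite /D mulrC.
  apply: derivation_ext; [exact: poisson_derr| |move=> w].
    by apply: derivation_lin; apply: poisson_derr.
  by rewrite /D /poisson !derX (derP _).2; ring.
pose D y := 0 * pb b y + (-1) * pb b y.
transitivity (D a); last by rewrite /D mul0r mulN1r add0r.
apply: (@derivation_ext (pb^~ b)) => // [|v].
  by apply: derivation_lin; apply: poisson_derr.
by rewrite X_pb /D /poisson derX; ring.
Qed.

HB.instance Definition _ a :=
  GRing.isLinear.Build F V V *:%R (pb a) (poisson_derr a).1.

Lemma poissonMr a b c : pb a (b * c) = pb a b * c + b * pb a c.
Proof. exact: (poisson_derr a).2. Qed.

Lemma poissonMl a b c : pb (a * b) c = pb a c * b + a * pb b c.
Proof. by rewrite poisson_skew poissonMr ![pb c _]poisson_skew; ring. Qed.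

Lemma poissonPl c a a' b : pb (c *: a + a') b = c *: pb a b + pb a' b.
Proof.
by rewrite poisson_skew linearP /= ![pb b _]poisson_skew scalerN opprD !opprK.
Qed.

Lemma poisson1r a : pb a 1 = 0.
Proof. exact: derivation1 (poisson_derr a). Qed.

Lemma poisson1l a : pb 1 a = 0.
Proof. by rewrite poisson_skew poisson1r oppr0. Qed.

Lemma poisson0l a : pb 0 a = 0.
Proof. by rewrite poisson_skew raddf0 oppr0. Qed.

(** For two generators in front, {X u, .} and {X v, .} have a commutator which is a derivation, so
    comparing it with {{X u, X v}, .} on generators is enough; induction on b and then on a does the
    rest. *)
Lemma poisson_jacobi :
  (forall u v w, pb (X u) (pi v w) = pb (pi u v) (X w) + pb (X v) (pi u w)) ->
  forall a b c, pb a (pb b c) = pb (pb a b) c + pb b (pb a c).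
Proof.
move=> jacX; have addl a a' b : pb (a + a') b = pb a b + pb a' b.
  by rewrite -[a]scale1r poissonPl !scale1r.
elim/V_rect=> [|u|a a' IHa IHa'|x a a' IHa IHa'] b c.
- by rewrite !poisson1l poisson0l raddf0 addr0.
- elim/V_rect: b c => [|v|b b' IHb IHb'|x b b' IHb IHb'] c.
  + by rewrite !(poisson1l, poisson1r) poisson0l raddf0 addr0.
  + have := derivation_ext
      (derivation_comm (poisson_derr (X u)) (poisson_derr (X v)))
      (poisson_derr (pb (X u) (X v))).
    move=> /(_ _ c) <-; first by rewrite subrK.
    by move=> w; rewrite !poissonX jacX addrK.
  + rewrite poissonMl raddfD /= !poissonMr IHb IHb' addl !poissonMl.
    by ring.
  rewrite poissonPl raddfD /= linearZ /= IHb IHb' linearP /= !poissonPl.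
  by rewrite scalerDr addrACA.
- rewrite poissonMl [pb (a * a') b]poissonMl [pb (a * a') c]poissonMl.
  rewrite IHa IHa' raddfD addl /= !poissonMl !poissonMr.
  by rewrite [pb b a]poisson_skew [pb b a']poisson_skew; ring.
rewrite !poissonPl IHa IHa' linearP /= scalerDr; exact: addrACA.
Qed.

Lemma poisson_autz k :
  (forall v w, pi (tau k v) (tau k w) = autz S k (pi v w)) ->
  forall a b, pb (autz S k a) (autz S k b) = autz S k (pb a b).
Proof.
move=> piS a b; elim/V_rect: a => [|v|a a' IHa IHa'|x a a' IHa IHa'].
- by rewrite rmorph1 !poisson1l raddf0.
- elim/V_rect: b => [|w|b b' IHb IHb'|x b b' IHb IHb'].
  + by rewrite rmorph1 !poisson1r raddf0.
  + by rewrite !autz_X !poissonX piS.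
  + by rewrite rmorphM /= !poissonMr IHb IHb' raddfD /= !rmorphM.
  by rewrite !linearP /= IHb IHb'.
- by rewrite rmorphM /= !poissonMl IHa IHa' raddfD /= !rmorphM.
by rewrite linearP /= !poissonPl IHa IHa' linearP.
Qed.

Definition local (a b : V) : Type :=
  {B : nat | forall n : int, (B < absz n)%N -> pb (autz S n a) b = 0}.

Lemma poisson_local : (forall v w, local (X v) (X w)) -> forall a b, local a b.
Proof.
move=> locX a b.
elim/V_rect: a => [|v|a a' [B aB] [B' aB']|x a a' [B aB] [B' aB']].
- by exists 0%N => n _; rewrite rmorph1 poisson1l.
- elim/V_rect: b => [|w|b b' [B bB] [B' bB']|x b b' [B bB] [B' bB']].
  + by exists 0%N => n _; rewrite poisson1r.
  + exact: locX.
  + exists (maxn B B') => n; rewrite gtn_max => /andP[Bn Bn'].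
    by rewrite poissonMr bB ?bB' // mul0r mulr0 addr0.
  exists (maxn B B') => n; rewrite gtn_max => /andP[Bn Bn'].
  by rewrite linearP /= bB ?bB' // scaler0 addr0.
- exists (maxn B B') => n; rewrite gtn_max => /andP[Bn Bn'].
  by rewrite rmorphM /= poissonMl aB ?aB' // mul0r mulr0 addr0.
exists (maxn B B') => n; rewrite gtn_max => /andP[Bn Bn'].
by rewrite linearP /= poissonPl aB ?aB' // scaler0 addr0.
Qed.

(* {a_λ b} = \sum_n λ^n {S^n(a), b} turns an S-invariant local Poisson bracket
   into a multiplicative Poisson vertex algebra structure. *)
Lemma poisson_mpva :
  (forall u v w, pb (X u) (pi v w) = pb (pi u v) (X w) + pb (X v) (pi u w)) ->
  (forall k v w, pi (tau k v) (tau k w) = autz S k (pi v w)) ->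
  (forall v w, local (X v) (X w)) ->
  exists br : V -> V -> laurent V, isMPVA S br /\
    forall a b n, (br a b)@_n = pb (autz S n a) b.
Proof.
move=> jacX piS locX.
have jac := poisson_jacobi jacX.
have pbS k := poisson_autz (piS k).
pose B a b : nat := sval (poisson_local locX a b).
(* The interval from -B to B, outside which locality makes the coefficients vanish. *)
pose s a b := [seq i%:Z - (B a b)%:Z | i <- iota 0 (B a b + B a b).+1].
pose br a b : laurent V :=
  [malg n in [fset m in s a b]%fset => pb (autz S n a) b].
have brE a b n : (br a b)@_n = pb (autz S n a) b.
  rewrite mcoeffE; case: ifP => // /negbT; rewrite in_fset /= => ns.
  apply/esym/(proj2_sig (poisson_local locX a b)).
  rewrite ltnNge; apply: contra ns => nB; apply/mapP.
  have {}nB : (absz n <= B a b)%N := nB.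
  by exists (absz (n + (B a b)%:Z)); rewrite ?mem_iota; lia.
exists br; split=> //; split.
- by move=> x a a' b n; rewrite !brE linearP /= poissonPl.
- by move=> x a b b' n; rewrite !brE linearP.
- by move=> a b n; rewrite !brE -[S a]/(autz S 1 a) autzD.
- move=> a b n; rewrite !brE -[S b]/(autz S 1 b) -[S (pb _ _)]/(autz S 1 _).
  by rewrite -pbS autzD addrC subrK.
- by move=> a b c n; rewrite !brE poissonMr; ring.
- by move=> a b c n; rewrite !brE rmorphM /= poissonMl; ring.
- by move=> a b n; rewrite !brE -pbS autzD subrr -poisson_skew.
(* S-invariance turns S^n {S^(m-n)(a), b} into {S^m(a), S^n(b)}, so the λ-Jacobi identity is the
   ordinary one for S^m(a), S^n(b), c. *)
move=> a b c m n; rewrite !brE -pbS autzD [n + _]addrC subrK jac.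
by rewrite addrK.
Qed.

End Poisson.

(** * Difference polynomials: substitutions, induction and derivations *)

Section DiffpolyDerivations.
Variables (F : fieldType) (I : choiceType).
Local Notation V := (diffpoly F I).
Local Notation dX := (@dX F I).

Definition subst_mon (A : comNzRingType) (s : dvar I -> A)
    (m : {cmonom dvar I}) : A :=
  \prod_(x <- finsupp m) s x ^+ m x.

Lemma subst_monEw (A : comNzRingType) (s : dvar I -> A) (d : {fset dvar I})
    (m : {cmonom dvar I}) :
  (finsupp m `<=` d)%fset -> subst_mon s m = \prod_(x <- d) s x ^+ m x.
Proof.
move=> le; rewrite /subst_mon (big_fset_incl _ le) // => x _ xm.
by move: xm; rewrite -cmE_eq0 => /eqP ->; rewrite expr0.
Qed.

Lemma subst_mon_is_mmorphism (A : comNzRingType) (s : dvar I -> A) :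
  mmorphism (subst_mon s).
Proof.
split=> [m1 m2|]; last by rewrite /subst_mon mdom1 big_seq_fset0.
rewrite !(@subst_monEw _ s (finsupp m1 `|` finsupp m2)%fset) ?mdomD
  ?fsubsetUl ?fsubsetUr //.
by rewrite -big_split /=; apply: eq_bigr => x _; rewrite cmM exprD.
Qed.

HB.instance Definition _ (A : comNzRingType) s :=
  isMultiplicative.Build {cmonom dvar I} A (@subst_mon A s)
    (subst_mon_is_mmorphism s).

Lemma subst_monU (A : comNzRingType) (s : dvar I -> A) x :
  subst_mon s (ucm x) = s x.
Proof. by rewrite /subst_mon mdomU big_seq_fset1 cmUU expr1. Qed.

Lemma diffpoly_rect : generates dX.
Proof.
move=> P P1 PX PM PZ a.
have P0 : P 0 by rewrite -(addNr 1) -scaleN1r; apply: PZ.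
have Pm (m : {cmonom dvar I}) : P << m >>.
  rewrite monomE; elim: (enum_fset (finsupp m)) => [|x s IHs].
    by rewrite big_nil.
  rewrite big_cons; apply: (PM) => //.
  elim: (m x) => [|n IHn]; first by rewrite expr0.
  by rewrite exprS; exact: PM (PX x) IHn.
rewrite (monalgE a); elim: (enum_fset (msupp a)) => [|m s IHs].
  by rewrite big_nil.
rewrite big_cons; have -> : << a@_m *g m >> = a@_m *: << m >> :> V.
  by rewrite -mul_malgC malgM_def fgmulUU mulr1 mul1m.
exact: PZ _ _ _ (Pm m) IHs.
Qed.

Lemma diffpoly_derivation : extends_to_derivations dX.
Proof.
move=> d; pose s x : {poly V} := (dX x)%:P + d x *: 'X.
pose c0 : {rmorphism F -> {poly V}} := polyC \o @mkmalgU {cmonom dvar I} F mone.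
pose phi : {rmorphism V -> {poly V}} := mmap c0 (subst_mon s).
apply: (dual_number_derivation diffpoly_rect (phi := phi)) => [c p|x].
  rewrite -[c%:A]mul_malgC mulr1; exact: mmapZ.
rewrite [LHS]mmapU /= subst_monU mpolyC1E; exact: mul1r.
Qed.

End DiffpolyDerivations.

(** * Symbols of pseudodifference operators in terms of coefficient sequences *)

Section PdoSymbol.
Variables (F : fieldType) (V : comAlgType F) (S : algAut V).

Lemma symbol_sub (A B : pdo V) n :
  symbol (pdo_sub A B) n = symbol A n - symbol B n.
Proof.
rewrite {1}/symbol /pdo_sub /=; case: leP => [nd|].
  by congr (symbol A _ - symbol B _); rewrite gez0_abs; lia.
rewrite gt_max => /andP[An Bn].
by rewrite /symbol !ifN ?subrr // -ltNge.
Qed.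

Lemma symbol_mul (A B : pdo V) n :
  symbol (pdo_mul S A B) n =
    if n <= pdo_deg A + pdo_deg B
    then tw S (pdo_deg A) (pdo_coef A) (pdo_coef B)
           (absz (pdo_deg A + pdo_deg B - n)%R)
    else 0.
Proof. by []. Qed.

Lemma deg_pdo_exp (A : pdo V) N n :
  pdo_deg A = N%:Z -> pdo_deg (pdo_exp S A n) = (n * N)%N%:Z.
Proof. by move=> dA; elim: n => //= n ->; rewrite dA mulSn PoszD. Qed.

Lemma coef_pdo_exp (A : pdo V) N n : pdo_deg A = N%:Z ->
  pdo_coef (pdo_exp S A n) =1 tw_exp S N (pdo_coef A) n.
Proof.
move=> dA; elim: n => //= n IHn k.
by rewrite dA; apply: eq_tw.
Qed.

End PdoSymbol.

(** * The Lax equation and the involution of the residues *)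

Section LaxEquation.
Variables (F : fieldType) (V : comAlgType F) (S : algAut V) (N : nat).
Variable u : int -> V.
Hypothesis u_gt : forall i : int, N%:Z < i -> u i = 0.
Local Notation L := (PDO N%:Z (fun k => u (N%:Z - k%:Z))).
Local Notation g := (fun k : nat => u (N%:Z - k%:Z)).
Local Notation tw_exp := (tw_exp S N g).

(* The sum over i < K covers all i for which u (j + i - d) != 0. *)
Lemma tw_ur (d : int) (b : nat -> V) (j : int) (K : nat) :
  d + N%:Z - j < K%:Z ->
  (if j <= d + N%:Z then tw S d b g (absz (d + N%:Z - j)%R) else 0)
    = \sum_(i < K) b i * autz S (d - (i : nat)%:Z) (u (j + (i : nat)%:Z - d)).
Proof.
move=> tK; case: leP => [jd|dj]; last first.
  by rewrite big1 // => i _; rewrite u_gt ?raddf0 ?mulr0 //; lia.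
rewrite /tw (big_ord_widen K (fun i => b i * autz S (d - i%:Z)
  (g (absz (d + N%:Z - j)%R - i)%N))); last by lia.
rewrite big_mkcond /=.
apply: eq_bigr => i _; case: ltnP => it /=.
  by congr (_ * autz S _ (u _)); lia.
by rewrite u_gt ?raddf0 ?mulr0 //; lia.
Qed.

Lemma tw_ul (d : int) (b : nat -> V) (j : int) (K : nat) :
  d + N%:Z - j < K%:Z ->
  (if j <= d + N%:Z then tw S N%:Z g b (absz (d + N%:Z - j)%R) else 0)
    = \sum_(i < K)
        u (j + (i : nat)%:Z - d) * autz S (j + (i : nat)%:Z - d) (b i).
Proof.
move=> tK; case: leP => [jd|dj]; last first.
  by rewrite big1 // => i _; rewrite u_gt ?mul0r //; lia.
(* Reversing the sum makes i the index of [b], in line with [tw_ur]. *)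
rewrite /tw (reindex_inj rev_ord_inj) /=.
rewrite (big_ord_widen K (fun i => g ((absz (d + N%:Z - j)%R).+1 - i.+1)%N *
  autz S (N%:Z - ((absz (d + N%:Z - j)%R).+1 - i.+1)%N%:Z)
    (b (absz (d + N%:Z - j)%R - ((absz (d + N%:Z - j)%R).+1 - i.+1))%N)));
  last by lia.
rewrite big_mkcond; apply: eq_bigr => i _; case: ltnP => it /=.
  by congr (u _ * autz S _ (b _)); lia.
by rewrite u_gt ?mul0r //; lia.
Qed.

Lemma pdo_plus_coef (B : pdo V) k :
  pdo_coef (pdo_plus B) k = pdo_coef B k *+ (k%:Z <= pdo_deg B)%R.
Proof. by rewrite /= subr_ge0; case: (_ <= _). Qed.

(** The contribution of the term of exponent d - i of L^n, with d = n N, to the coefficient of S^j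
    in [L^n, L]. *)
Definition lax_term n (d j : int) (i : nat) : V :=
  tw_exp n i * autz S (d - i%:Z) (u (j + i%:Z - d))
    - u (j + i%:Z - d) * autz S (j + i%:Z - d) (tw_exp n i).

Lemma symbol_comm_plus n (d j : int) (K : nat) : d = (n * N)%N%:Z ->
  d + N%:Z - j < K%:Z ->
  symbol (pdo_comm S (pdo_plus (pdo_exp S L n)) L) j
    = \sum_(i < K) lax_term n d j i *+ ((i : nat)%:Z <= d)%R.
Proof.
move=> dE tK; have dB := deg_pdo_exp S n (erefl : pdo_deg L = N%:Z).
rewrite /pdo_comm symbol_sub.
pose p := pdo_coef (pdo_plus (pdo_exp S L n)).
have pE i : p i = tw_exp n i *+ (i%:Z <= d)%R.
  rewrite /p pdo_plus_coef dB -dE.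
  by rewrite (coef_pdo_exp _ _ (erefl : pdo_deg L = N%:Z)).
transitivity ((if j <= d + N%:Z then tw S d p g (absz (d + N%:Z - j)%R) else 0)
    - (if j <= d + N%:Z then tw S N%:Z g p (absz (d + N%:Z - j)%R) else 0)).
  have dP : pdo_deg (pdo_plus (pdo_exp S L n)) = d by rewrite dE.
  by rewrite !symbol_mul dP (addrC (pdo_deg L)).
rewrite (tw_ur _ tK) (tw_ul _ tK) -sumrB; apply: eq_bigr => i _.
by rewrite pE mulrnBl raddfMn mulrnAl mulrnAr.
Qed.

Variable br : V -> V -> laurent V.
Hypotheses (N_gt0 : (0 < N)%N) (br_mpva : isMPVA S br).
Hypothesis charF : [pchar F] =i pred0.
Hypothesis u_top : u N%:Z = 1.

Definition u_br (i j : int) : laurent V :=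
  (<< autz S (- i) (u (i + j)) *g - i >> - << u (i + j) *g j >>) *~ eps i j.

(** The conventions for u_i with i >= N are consistent: [eps] is nonzero only if j >= 1, and then i
    + j > N. Hence [br_u] holds for all indices and the trace computation has no boundary cases. *)
Lemma u_br_gel (i j : int) : N%:Z <= i -> u_br i j = 0.
Proof.
move=> iN; rewrite /u_br /eps; case: ifP => [/andP[_ j1]|_].
  have -> : u (i + j) = 0 by apply: u_gt; lia.
  by rewrite raddf0 !monalgU0 subrr mul0rz.
by rewrite ifF ?mulr0z //; lia.
Qed.

Lemma u_br_ger (i j : int) : N%:Z <= j -> u_br i j = 0.
Proof.
move=> jN; rewrite /u_br /eps; case: ifP => [/andP[i1 _]|_].
  have -> : u (i + j) = 0 by apply: u_gt; lia.
  by rewrite raddf0 !monalgU0 subrr mul0rz.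
by rewrite ifF ?mulr0z //; lia.
Qed.

Hypothesis br_u_lt :
  forall i j : int, i <= N%:Z - 1 -> j <= N%:Z - 1 -> br (u i) (u j) = u_br i j.

Lemma br_u (i j : int) : br (u i) (u j) = u_br i j.
Proof.
have [iN|] := leP i (N%:Z - 1); last first.
  rewrite ltrBlDr ltzD1 => Ni; rewrite u_br_gel //.
  have [->|iN] := eqVneq i N%:Z; first by rewrite u_top (br1l br_mpva).
  have -> : u i = 0 by apply: u_gt; lia.
  exact: br0l br_mpva _.
have [jN|] := leP j (N%:Z - 1); first exact: br_u_lt.
rewrite ltrBlDr ltzD1 => Nj; rewrite u_br_ger //.
have [->|jN] := eqVneq j N%:Z; first by rewrite u_top (br1r br_mpva).
have -> : u j = 0 by apply: u_gt; lia.
exact: br0r br_mpva _.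
Qed.

Lemma omega_u f (k j : int) : omega S br (u j) f (u k)
  = (autz S (- k) (f * u (k + j)) - autz S j f * u (k + j)) *~ eps k j.
Proof.
by rewrite /omega br_u /u_br raddfMz raddfB /= !pairU rmorphM.
Qed.

Lemma Om_u n (d j : int) (K : nat) : d = (n * N)%N%:Z ->
  (n.+1 * N < K)%N ->
  Om S br (u j) d (tw_exp n) g (n.+1 * N)%N
    = \sum_(i < K) lax_term n d j i *~ eps ((i : nat)%:Z - d) j.
Proof.
move=> dE nK; rewrite /Om.
transitivity (\sum_(i < (n.+1 * N).+1)
                lax_term n d j i *~ eps ((i : nat)%:Z - d) j).
  apply: eq_bigr => i _.
  (* The coefficient of L paired with the i-th one of L^n in the residue is u_(i - d). *)
  have iE : N%:Z - (n.+1 * N - i)%N%:Z = (i : nat)%:Z - d.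
    by have := ltn_ord i; have := mulSn n N; rewrite dE; lia.
  rewrite /= iE (omega_autz br_mpva) omega_u /lax_term.
  have -> : (i : nat)%:Z - d + j = j + (i : nat)%:Z - d by ring.
  rewrite rmorphM /= !autzD (mulrC (u _)).
  have -> : - ((i : nat)%:Z - d) + - (d - (i : nat)%:Z) = 0 by ring.
  have -> : j + - (d - (i : nat)%:Z) = j + (i : nat)%:Z - d by ring.
  by rewrite opprB.
rewrite (big_ord_widen K (fun i => lax_term n d j i *~ eps (i%:Z - d) j)) //.
(* The added terms vanish: here i - d > N, so either j >= 1 and u_(j + i - d) = 0, or j <= 0 and
   [eps] is 0. *)
rewrite big_mkcond; apply: eq_bigr => i _; case: ltnP => // iN.
have {}iN : d + N%:Z < (i : nat)%:Z by rewrite dE; lia.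
rewrite /eps; case: ifP => [/andP[_ j1]|_]; last by rewrite ifF //; lia.
by rewrite /lax_term u_gt ?raddf0 ?mulr0 ?mul0r ?subrr ?mul0rz //; lia.
Qed.

Lemma lax_comm0 n (d j : int) (K : nat) : d = (n * N)%N%:Z ->
  d + N%:Z - j < K%:Z -> \sum_(i < K) lax_term n d j i = 0.
Proof.
move=> dE tK; rewrite /lax_term sumrB -(tw_ur _ tK) -(tw_ul _ tK).
by rewrite dE tw_expSr subrr.
Qed.

Local Notation hdens n := (- (n%:R^-1 *: tw_exp n (n * N)%N)).

(** The trace formula gives minus the sum of the Lax terms weighted by [eps]. For j <= 0 the weight
    is -1 exactly for i <= d, which is [(L^n)_+, L]; for j >= 1 it is 1 exactly for i > d, and
    [L^n, L] = 0 trades this half for the other. *)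
Lemma lax_equation n (j : int) :
  ham_action br (hdens n.+1) (u j)
    = symbol (pdo_comm S (pdo_plus (pdo_exp S L n)) L) j.
Proof.
have n_neq0 : n.+1%:R != 0 :> F by have/pcharf0P -> := charF.
pose d := (n * N)%N%:Z; pose K := ((n.+1 * N).+1 + `|j|)%N.
have tK : d + N%:Z - j < K%:Z by rewrite /d /K mulSn; lia.
have nK : (n.+1 * N < K)%N by rewrite /K; lia.
rewrite (ham_actionE S) -scaleNr (omegaZr br_mpva).
rewrite (omega_res_tw_exp br_mpva) -scaler_nat scalerA mulNr mulVf // scaleN1r.
rewrite (Om_u _ (erefl d) nK) (symbol_comm_plus (erefl d) tK).
have [j0|j1] := leP j 0.
  rewrite -sumrN; apply: eq_bigr => i _; rewrite -mulrNz /eps.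
  rewrite ifF; last lia.
  rewrite j0 andbT subr_le0.
  by case: (_ <= d); rewrite ?opprK ?oppr0.
transitivity (\sum_(i < K) lax_term n d j i *+ ((i : nat)%:Z <= d)%R
              - \sum_(i < K) lax_term n d j i); last first.
  by rewrite (lax_comm0 (erefl d) tK) subr0.
rewrite -sumrN -sumrB; apply: eq_bigr => i _; rewrite /eps.
have -> : (1 <= (i : nat)%:Z - d) = ~~ ((i : nat)%:Z <= d) by lia.
have -> : (1 <= j) = true by lia.
rewrite (lt_geF j1) andbT andbF.
by case: (_ <= d); rewrite /= ?subrr ?sub0r ?oppr0.
Qed.

Lemma pad_lax n d t : d = (n * N)%N ->
  pad d (ham_action br (hdens n.+1) \o g) t
    = tw S d%:Z (pdo_coef (pdo_plus (pdo_exp S L n))) g t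
      - tw S N%:Z g (pdo_coef (pdo_plus (pdo_exp S L n))) t.
Proof.
move=> dE; pose j := d%:Z + N%:Z - t%:Z.
have dB : pdo_deg (pdo_exp S L n) = d%:Z.
  by rewrite (deg_pdo_exp S n (erefl : pdo_deg L = N%:Z)) dE.
transitivity (ham_action br (hdens n.+1) (u j)).
  have [td|dt] := ltnP t d.
    by rewrite pad_lt // u_gt ?(der0 (ham_actionD br_mpva _)) // /j; lia.
  rewrite -(subnKC dt) padD /=; congr (ham_action _ _ (u _)); rewrite /j; lia.
rewrite lax_equation symbol_sub !symbol_mul.
rewrite -[pdo_deg (pdo_plus _)]/(pdo_deg (pdo_exp S L n)) dB.
rewrite [pdo_deg L]/= (addrC N%:Z).
have -> : j <= d%:Z + N%:Z by rewrite /j; lia.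
by have -> : absz (d%:Z + N%:Z - j)%R = t by rewrite /j; lia.
Qed.

Lemma hdens_involution m n :
  eq_int S (ham_action br (hdens m.+1) (hdens n)) 0.
Proof.
rewrite -[X in ham_action _ _ X]scaleNr (ham_actionZ br_mpva); apply: eq_int0Z.
pose d := (m * N)%N; set D := ham_action br _.
rewrite -[D _]/((D \o tw_exp n) (n * N)%N) -(padD d).
rewrite (der_tw_exp (ham_actionD br_mpva _) (ham_actionM br_mpva _)
  (ham_actionS br_mpva _) (fun t => pad_lax t (erefl d))).
by apply/eq_int_subr0/eq_int_tw_comm; rewrite PoszD.
Qed.

End LaxEquation.

Section MatrixUnitBracket.
Variables (F : fieldType) (V : comAlgType F) (S : algAut V) (N : nat).
Variable u : int -> V.
Hypotheses (N_gt0 : (0 < N)%N) (u_top : u N%:Z = 1).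
Hypothesis u_gt : forall i : int, N%:Z < i -> u i = 0.

(* The entries of the matrix of L = \sum_i u_i S^i, acting on sequences. *)
Definition munit (a b : int) : V := autz S a (u (b - a)).

(* The commutator relations of gl_oo, twisted by the sign eps. *)
Definition munit_br (a b c d : int) : V :=
  (munit a d *+ (b == c) - munit c b *+ (d == a)) *~ eps (b - a) (d - c).

Definition lvl (v : dvar (idx N)) : int := val v.1.

Definition gen_br (v w : dvar (idx N)) : V :=
  munit_br v.2 (v.2 + lvl v) w.2 (w.2 + lvl w).

Lemma eps_sym i j : eps i j = eps j i.
Proof. by rewrite /eps ![(1 <= i) && _]andbC ![(i <= 0) && _]andbC. Qed.

Lemma munit_br_skew a b c d : munit_br a b c d = - munit_br c d a b.
Proof. by rewrite /munit_br -mulNrz opprB eps_sym. Qed.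

Lemma gen_br_skew v w : gen_br v w = - gen_br w v.
Proof. exact: munit_br_skew. Qed.

Lemma autz_munit k a b : autz S k (munit a b) = munit (a + k) (b + k).
Proof.
by rewrite /munit autzD [k + a]addrC opprD addrACA subrr addr0.
Qed.

Lemma autz_munit_br k a b c d :
  autz S k (munit_br a b c d) = munit_br (a + k) (b + k) (c + k) (d + k).
Proof.
rewrite /munit_br raddfMz raddfB !raddfMn /= !autz_munit.
rewrite !(inj_eq (addIr k)); congr (_ *~ eps _ _); ring.
Qed.

Lemma munit_top a : munit a (a + N%:Z) = 1.
Proof. by rewrite /munit addrC addKr u_top rmorph1. Qed.

Lemma munit_gt a b : N%:Z < b - a -> munit a b = 0.
Proof. by move=> ab; rewrite /munit u_gt ?raddf0. Qed.

Lemma munit_br_gel a b c d : N%:Z <= b - a -> munit_br a b c d = 0.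
Proof.
move=> ab; rewrite /munit_br /eps; case: ifP => [/andP[_ cd]|_]; last first.
  by rewrite ifF ?mulr0z //; lia.
have -> : munit a d *+ (b == c) = 0.
  by case: eqP => // bc; rewrite munit_gt //; lia.
have -> : munit c b *+ (d == a) = 0.
  by case: eqP => // da; rewrite munit_gt //; lia.
by rewrite subrr mul0rz.
Qed.

Variable X : dvar (idx N) -> V.
Hypothesis X_munit : forall v, X v = munit v.2 (v.2 + lvl v).
Hypotheses (V_rect : generates X) (V_der : extends_to_derivations X).

Lemma munit_X a b : b - a <= N%:Z - 1 ->
  exists v : dvar (idx N), [/\ v.2 = a, v.2 + lvl v = b & X v = munit a b].
Proof.
move=> ab; exists (Sub (b - a) ab : idx N, a).
have E : a + (b - a) = b by rewrite addrC subrK.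
by split; rewrite ?X_munit /lvl /= ?E.
Qed.

Local Notation pb := (poisson V_der gen_br).

Lemma poisson_munit a b c d : pb (munit a b) (munit c d) = munit_br a b c d.
Proof.
have munit_ge a' b' : ~~ (b' - a' <= N%:Z - 1) ->
    [/\ N%:Z <= b' - a' & munit a' b' = 0 \/ munit a' b' = 1].
  rewrite -ltNge ltrBlDr ltzD1 => ab; split=> //.
  have [e|ne] := eqVneq (b' - a') N%:Z; [right|left].
    by rewrite -(munit_top a') -e [a' + _]addrC subrK.
  by rewrite munit_gt // lt_neqAle eq_sym ne.
have [/munit_X[v [va vb vE]]|/munit_ge[ab]] := boolP (b - a <= N%:Z - 1).
  have [/munit_X[w [wc wd wE]]|/munit_ge[cd]] := boolP (d - c <= N%:Z - 1).
    by rewrite -vE -wE (poissonX V_der gen_br_skew) /gen_br vb wd va wc.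
  rewrite munit_br_skew munit_br_gel // oppr0.
  by case=> ->; rewrite ?raddf0 ?poisson1r.
rewrite munit_br_gel //.
case=> ->.
  exact: (poisson0l V_rect V_der gen_br_skew).
exact: (poisson1l V_rect V_der gen_br_skew).
Qed.

Definition eps3 (i j k : int) : int :=
  ((1 <= i) && (1 <= j) && (1 <= k) || (i <= 0) && (j <= 0) && (k <= 0)).

Lemma epsM i j k : eps i (j + k) * eps j k = eps3 i j k.
Proof.
have ge1 (x : int) : (1 <= x) = ~~ (x <= 0) by lia.
rewrite /eps /eps3 !ge1; have [j0|j0] := leP j 0; have [k0|k0] := leP k 0.
- have -> : j + k <= 0 by lia.
  by case: (i <= 0).
- by rewrite mulr0 !andbF.
- by rewrite mulr0 !andbF.
rewrite (lt_geF (addr_gt0 j0 k0)).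
by case: (i <= 0).
Qed.

Lemma poisson_munit_br a b c d e f :
  pb (munit a b) (munit_br c d e f)
    = ((munit a f *+ (b == c) - munit c b *+ (f == a)) *+ (d == e)
        - (munit a d *+ (b == e) - munit e b *+ (d == a)) *+ (f == c))
      *~ eps3 (b - a) (d - c) (f - e).
Proof.
have dE : d = e -> eps (b - a) (f - c) * eps (d - c) (f - e)
    = eps3 (b - a) (d - c) (f - e).
  by move=> ->; rewrite -epsM; congr (eps _ _ * _); lia.
have fE : f = c -> eps (b - a) (d - e) * eps (d - c) (f - e)
    = eps3 (b - a) (d - c) (f - e).
  by move=> ->; rewrite -epsM; congr (eps _ _ * _); lia.
rewrite /munit_br raddfMz raddfB !(raddfMn (pb (munit a b))) /=.
rewrite !poisson_munit /munit_br.
case: (eqVneq d e) => [/dE {}dE|_]; case: (eqVneq f c) => [/fE {}fE|_];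
  rewrite ?mulr1n ?mulr0n ?subr0 ?sub0r ?mul0rz //.
- by rewrite [LHS]mulrzBl -!mulrzA dE fE -mulrzBl.
- by rewrite -mulrzA dE.
by rewrite !mulNrz -mulrzA fE.
Qed.

Lemma gen_br_jacobi v w x :
  pb (X v) (gen_br w x) = pb (gen_br v w) (X x) + pb (X w) (gen_br v x).
Proof.
rewrite !X_munit /gen_br.
rewrite [pb (munit_br _ _ _ _) _](poisson_skew V_rect V_der gen_br_skew).
rewrite !poisson_munit_br.
set a := v.2; set b := a + _; set c := w.2; set d := c + _.
set e := x.2; set f := e + _.
have -> : eps3 (f - e) (b - a) (d - c) = eps3 (b - a) (d - c) (f - e).
  by rewrite /eps3; lia.
have -> : eps3 (d - c) (b - a) (f - e) = eps3 (b - a) (d - c) (f - e).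
  by rewrite /eps3; lia.
rewrite -mulNrz -mulrzDl; congr (_ *~ _).
rewrite ![d == a]eq_sym.
by case: (b == c); case: (d == e); case: (f == a); case: (b == e);
  case: (a == d); case: (f == c); rewrite ?mulr0n ?mulr1n; ring.
Qed.

Lemma generic_mpva : (forall k v, autz S k (X v) = X (v.1, v.2 + k)) ->
  exists br : V -> V -> laurent V, isMPVA S br /\ forall i j, br (u i) (u j)
    = (<< autz S (- i) (u (i + j)) *g - i >> - << u (i + j) *g j >>) *~ eps i j.
Proof.
move=> autz_X.
have [|k v w|v w|br [br_mpva brE]] :=
  @poisson_mpva _ _ _ _ V_rect V_der S (fun k v => (v.1, v.2 + k)) autz_X
    _ gen_br_skew.
- exact: gen_br_jacobi.
- by rewrite /gen_br autz_munit_br /= ![_ + k + _]addrAC.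
- exists (absz v.2 + absz (lvl v) + absz w.2 + absz (lvl w))%N => n nB.
  rewrite autz_X !X_munit poisson_munit /munit_br /=.
  have -> : (v.2 + n + lvl v == w.2) = false by lia.
  have -> : (w.2 + lvl w == v.2 + n) = false by lia.
  by rewrite subrr mul0rz.
exists br; split=> // i j; apply/malgP => n.
have uE k : u k = munit 0 k by rewrite /munit subr0.
rewrite brE !uE autz_munit poisson_munit /munit_br add0r addrK subr0.
rewrite [RHS](raddfMz (mcoeff n)) /= mcoeffB !mcoeffU; congr (_ *~ _).
congr (_ - _).
  rewrite autz_munit add0r addrAC subrr add0r.
  rewrite -[- i == n]subr_eq0 -[i + n == 0]oppr_eq0 opprD.
  by case: eqP => // in0; congr (munit _ _); lia.
by case: eqP => // ->; congr (munit _ _); lia.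
Qed.

End MatrixUnitBracket.

Lemma eq_lin_indep_int (F : fieldType) (V : comAlgType F) (S : algAut V)
    (h h' : nat -> V) : h =1 h' -> lin_indep_int S h -> lin_indep_int S h'.
Proof.
move=> hh' h_free k x sum0; apply: h_free.
by under eq_bigr do rewrite hh'.
Qed.

Lemma rmorph_aut_invariant (F : fieldType) (V : comAlgType F) (S : algAut V)
    (J : Type) (X : J -> V) (A : lalgType F) (phi : {rmorphism V -> A}) :
  generates X -> (forall c a, phi (c *: a) = c *: phi a) ->
  (forall x, phi (S (X x)) = phi (X x)) -> forall a, phi (S a) = phi a.
Proof.
move=> V_rect phiZ phiX; elim/V_rect=> [|//|a b IHa IHb|c a b IHa IHb].
- by rewrite !rmorph1.
- by rewrite !rmorphM IHa IHb.
by rewrite linearP !rmorphD !phiZ IHa IHb.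
Qed.

Section Independence.
Variables (F : fieldType) (V : comAlgType F) (S : algAut V) (N : nat).
Variables (g : nat -> V) (phi : {rmorphism V -> {poly F}}).
Hypothesis phiZ : forall c a, phi (c *: a) = c *: phi a.
Hypotheses (N_gt0 : (0 < N)%N) (phi_S : forall a, phi (S a) = phi a).
Hypothesis phi_g :
  forall k, phi (g k) = (k == 0)%:R + 'X *+ (k == N)%N.

Lemma phi_tw_exp n k : ((n * N)%N <= k)%N ->
  phi (tw_exp S N g n k) = 'X^n *+ (k == n * N)%N.
Proof.
have phi_autz j a : phi (autz S j a) = phi a.
  elim/int_ind: j => [//|j IHj|j IHj].
    by rewrite -add1n PoszD autz1D phi_S.
  by rewrite -phi_S -autz1D (_ : 1 + - j.+1%:Z = - j%:Z) //; lia.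
elim: n k => [|n IHn] k nk; first by rewrite rmorph_nat mul0n expr0.
have Nk : (N < k.+1)%N by move: nk; rewrite mulSn; lia.
rewrite /= /tw raddf_sum (bigD1 (Ordinal Nk)) //= [X in _ + X]big1 => [|i].
  rewrite rmorphM /= phi_autz phi_g eqxx.
  rewrite (_ : (N == 0)%N = false) ?add0r; last lia.
  rewrite IHn; last by move: nk; rewrite mulSn; lia.
  rewrite addr0 mulr1n mulrnAr -exprS mulSn; congr (_ *+ _); lia.
rewrite -(inj_eq val_inj) /= => iN.
rewrite rmorphM /= phi_autz phi_g (negPf iN) mulr0n addr0.
case: eqP => [i0|_]; last by rewrite mul0r.
rewrite mul1r i0 subn0 IHn; last by move: nk; rewrite mulSn; lia.
by rewrite (_ : k == _ = false) //; move: nk; rewrite mulSn; lia.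
Qed.

Hypothesis charF : [pchar F] =i pred0.

Lemma lin_indep_tw_exp :
  lin_indep_int S (fun n => - (n.+1%:R^-1 *: tw_exp S N g n.+1 (n.+1 * N)%N)).
Proof.
have phi_h n : phi (- (n.+1%:R^-1 *: tw_exp S N g n.+1 (n.+1 * N)%N))
    = - (n.+1%:R^-1 *: 'X^(n.+1)).
  rewrite raddfN; congr (- _); rewrite [LHS]phiZ; congr (_ *: _).
  by rewrite [LHS]phi_tw_exp // eqxx.
move=> k x [c]; rewrite subr0 => sumE i.
have sum0 : \sum_(j < k) x j *: - (j.+1%:R^-1 *: 'X^(j.+1)) = 0 :> {poly F}.
  rewrite -[RHS](subrr (phi c)) -{1}phi_S -rmorphB -sumE raddf_sum.
  apply: eq_bigr => j _; rewrite [RHS]phiZ; congr (_ *: _).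
  exact/esym/phi_h.
move/(congr1 (fun p : {poly F} => p`_i.+1)): sum0.
rewrite coef0 coef_sum (bigD1 i) //= big1 => [|j ji].
  rewrite addr0 coefZ coefN coefZ coefXn eqxx mulr1 mulrN => /eqP.
  rewrite oppr_eq0 mulf_eq0 invr_eq0.
  by have/pcharf0P -> := charF; rewrite orbF => /eqP.
rewrite coefZ coefN coefZ coefXn.
by rewrite eqSS (inj_eq val_inj) eq_sym (negPf ji) mulr0 oppr0 mulr0.
Qed.

End Independence.

Section GenericOperator.
Variables (F : fieldType) (N : nat).
Local Notation V := (diffpoly F (idx N)).
Local Notation S := (dshift F (idx N)).
Local Notation gen := (gen F N).

Lemma gen_gt i : N%:Z < i -> gen i = 0.
Proof.
move=> Ni; rewrite /Defs.gen insubF ?gt_eqF //.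
by apply/negbTE; rewrite -ltNge; lia.
Qed.

Lemma gen_top : gen N%:Z = 1.
Proof.
by rewrite /Defs.gen insubF ?eqxx //; apply/negbTE; rewrite -ltNge; lia.
Qed.

Lemma autz_dX k (v : dvar (idx N)) : autz S k (dX F v) = dX F (v.1, v.2 + k).
Proof. by rewrite autz_dshift; exact: shiftX. Qed.

Lemma gen_val (i : idx N) : gen (val i) = dX F (i, 0).
Proof. by rewrite /Defs.gen valK. Qed.

Lemma dX_munit (v : dvar (idx N)) : dX F v = munit S gen v.2 (v.2 + lvl v).
Proof.
rewrite /munit /lvl addrC addKr gen_val autz_dX /= add0r.
by rewrite -surjective_pairing.
Qed.

Lemma hdensE n : hdens F N n
  = - (n%:R^-1 *: tw_exp S N (fun k => gen (N%:Z - k%:Z)) n (n * N)%N).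
Proof.
rewrite /hdens /mRes /symbol.
rewrite (deg_pdo_exp S n (erefl : pdo_deg (genL F N) = N%:Z)) subr0.
by rewrite (coef_pdo_exp S n (erefl : pdo_deg (genL F N) = N%:Z)).
Qed.

Definition spec_var (v : dvar (idx N)) : {poly F} := 'X *+ (lvl v == 0).

Lemma spec_exists : exists phi : {rmorphism V -> {poly F}},
  (forall c a, phi (c *: a) = c *: phi a) /\
  (forall v, phi (dX F v) = spec_var v).
Proof.
exists (mmap (@polyC F) (subst_mon spec_var)); split=> [c a|v].
  rewrite -[RHS]mul_polyC; exact: mmapZ.
rewrite [LHS]mmapU /= subst_monU; exact: mul1r.
Qed.

Section Specialization.
Variable phi : {rmorphism V -> {poly F}}.
Hypothesis phiX : forall v, phi (dX F v) = spec_var v.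

Lemma spec_dshift v : phi (S (dX F v)) = phi (dX F v).
Proof.
have -> : S (dX F v) = dX F (v.1, v.2 + 1) by exact: shiftX.
by rewrite [LHS]phiX [RHS]phiX.
Qed.

Lemma spec_gen (k : nat) : (0 < N)%N ->
  phi (gen (N%:Z - k%:Z)) = (k == 0)%:R + 'X *+ (k == N).
Proof.
move=> N_gt0; case: k => [|k].
  by rewrite subr0 gen_top rmorph1 (_ : 0 == N = false) ?addr0 //; lia.
have kN : N%:Z - k.+1%:Z <= N%:Z - 1 by lia.
rewrite -[N%:Z - _]/(val (Sub (N%:Z - k.+1%:Z) kN : idx N)) gen_val [LHS]phiX.
rewrite add0r /spec_var /lvl /=; congr (_ *+ _); lia.
Qed.

End Specialization.

End GenericOperator.

Theorem theorem9p1 (F : fieldType) (N : nat) :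
  [pchar F] =i pred0 -> (1 <= N)%N ->
  let V := diffpoly F (idx N) in
  let S := dshift F (idx N) in
  let L := genL F N in
  (exists br : V -> V -> laurent V, isMPVA1 br) /\
  (forall br : V -> V -> laurent V, isMPVA1 br ->
     (forall n : nat, (1 <= n)%N -> forall i : int,
        ham_action br (hdens F N n) (symbol L i)
          = symbol (pdo_comm S (pdo_plus (pdo_exp S L n.-1)) L) i) /\
     integrable_hierarchy S br (fun n => hdens F N n.+1)).
Proof.
move=> charF N_gt0 V S L; split.
  have [br [br_mpva brE]] := generic_mpva N_gt0 (gen_top F N) (@gen_gt F N)
    (@dX_munit F N) (@diffpoly_rect F (idx N))
    (@diffpoly_derivation F (idx N)) (@autz_dX F N).
  by exists br; split=> // i j _ _; rewrite brE.
move=> br [br_mpva brE]; split=> [[//|n] _ i|].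
  rewrite symbol_genL hdensE.
  exact: (lax_equation (@gen_gt F N) N_gt0 br_mpva charF (gen_top F N) brE).
split=> [|m n]; last first.
  rewrite !hdensE.
  exact: (hdens_involution (@gen_gt F N) N_gt0 br_mpva charF (gen_top F N) brE).
have [phi [phiZ phiX]] := spec_exists F N.
have phi_S := rmorph_aut_invariant (@diffpoly_rect F (idx N)) phiZ
  (spec_dshift phiX).
apply: (eq_lin_indep_int (fun n => esym (hdensE F N n.+1))).
exact: lin_indep_tw_exp phiZ N_gt0 phi_S (fun k => spec_gen phiX k N_gt0) charF.
Qed.
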